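(* Let $\rho\in[0,1)$. Suppose the basic assumptions (i)–(vi) listed in the context hold, that the pair $(f_1,h)$ is $L$-smad on $C$ for some $L>0$, and that $\mathcal{S}_{\lambda'}(x,y)\subset C$ for all $x,y\in C$ and all $\lambda'>0$. Suppose moreover that: (a) $\operatorname{dom} h=\mathbb{R}^d$ and $h$ is $\sigma$-strongly convex on $\mathbb{R}^d$ (for some $\sigma>0$); (b) $\nabla h$ and $\nabla f_1$ are Lipschitz continuous on any bounded subset of $\mathbb{R}^d$; (c) $\Psi$ is level-bounded, i.e., for every $r\in\mathbb{R}$ the set $\{x\in\mathbb{R}^d\mid \Psi(x)\le r\}$ is bounded; (d) $f_2$ is continuously differentiable on an open set $\mathcal{N}_0\subset\mathbb{R}^d$ that contains the set $\mathcal{X}$ of all limiting critical points of $(\mathcal{P})$, and $\nabla f_2$ is locally Lipschitz continuous on $\mathcal{N}_0$; (e) $g$ is convex; (f) there exists a bounded $u$ such that $u\in\partial(\nabla h)$ on any bounded subset of $\mathbb{R}^d$. Let $\{x^k\}_{k=0}^\infty$ be a sequence generated by BPDCAe (with parameter $\rho$) with $0<\lambda L<1$ and suppose that $\{x^k\}_{k=0}^\infty$ converges to some $\tilde x\in\mathcal{X}$. Suppose further that the auxiliary function $H_M(x,y)=\Psi(x)+MD_h(y,x)$, with $M>0$ satisfying $\frac\rho\lambda\le M\le\frac1\lambda$, is a KL function on $\mathbb{R}^d\times\mathbb{R}^d$ with the function $\phi$ in the KL inequality taking the form $\phi(s)=cs^{1-\theta}$ for some $\theta\in[0,1)$ and $c>0$.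 Then: (i) if $\theta=0$, there exists $k_0>0$ such that $x^k$ is constant for $k>k_0$; (ii) if $\theta\in(0,\frac12]$, there exist $c_1>0$, $k_1>0$ and $\eta\in(0,1)$ such that $\|x^k-\tilde x\|<c_1\eta^k$ for $k>k_1$; (iii) if $\theta\in(\frac12,1)$, there exist $c_2>0$ and $k_2>0$ such that $\|x^k-\tilde x\|<c_2k^{-\frac{1-\theta}{2\theta-1}}$ for $k>k_2$.
   Context: $\|\cdot\|$ is the Euclidean norm, $C\subset\mathbb{R}^d$ is a nonempty, convex, open set, $\overline{C}$ its closure. For convex $f$, $\partial_{\mathrm c}f(x)=\{\xi\in\mathbb{R}^d\mid f(y)-f(x)-\langle\xi,y-x\rangle\ge 0\ \forall y\in\mathbb{R}^d\}$. Limiting subdifferential: for proper lower semicontinuous $f$ and $x\in\operatorname{dom} f$, $\partial f(x)$ is the set of $\xi$ for which there exist $x^k\to x$ with $f(x^k)\to f(x)$ and $\xi^k\to\xi$ such that $\liminf_{y\to x^k,\,y\ne x^k}\frac{f(y)-f(x^k)-\langle\xi^k,y-x^k\rangle}{\|y-x^k\|}\ge 0$ for each $k$. Kernel generating distance: $h\in\mathcal{G}(C)$ means $h:\mathbb{R}^d\to(-\infty,+\infty]$ is proper, lower semicontinuous and convex, $\operatorname{dom} h\subset\overline{C}$, $\operatorname{dom}\partial h=C$, and $h$ is $\mathcal{C}^1$ on $\operatorname{int}\operatorname{dom} h=C$. Bregman distance: $D_h(x,y)=h(x)-h(y)-\langle\nabla h(y),x-y\rangle$ for $x\in\operatorname{dom}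 h$, $y\in C$. $L$-smad: $(f,h)$ is $L$-smooth adaptable ($L$-smad) on $C$, $L>0$, if $h\in\mathcal{G}(C)$, $f:\mathbb{R}^d\to(-\infty,+\infty]$ is proper and lower semicontinuous with $\operatorname{dom} h\subset\operatorname{dom} f$ and $\mathcal{C}^1$ on $C$, and $Lh-f$ and $Lh+f$ are convex on $C$. Problem $(\mathcal{P})$: minimize $\Psi(x)=f_1(x)-f_2(x)+g(x)$ over $x\in\overline{C}$. Basic assumptions: (i) $h\in\mathcal{G}(C)$ with $\overline{C}=\overline{\operatorname{dom} h}$; (ii) $f_1:\mathbb{R}^d\to(-\infty,+\infty]$ is proper and convex with $\operatorname{dom} h\subset\operatorname{dom}(f_1+g)$, and $\mathcal{C}^1$ on $C$; (iii) $f_2:\mathbb{R}^d\to(-\infty,+\infty]$ is proper and convex; (iv) $g:\mathbb{R}^d\to(-\infty,+\infty]$ is proper and lower semicontinuous with $\operatorname{dom} g\cap C\neq\emptyset$; (v) $v(\mathcal{P}):=\inf\{\Psi(x)\mid x\in\overline{C}\}>-\infty$; (vi) for any $\lambda>0$, $\lambda g+h$ is supercoercive: $\lim_{\|u\|\to\infty}\frac{\lambda g(u)+h(u)}{\|u\|}=\infty$. For $x,y\in C$, $\xi\in\partial_{\mathrm c}f_2(x)$, $\lambda>0$: $\mathcal{S}_\lambda(x,y):=\operatorname{argmin}_{u\in\overline{C}}\{g(u)+\langle\nabla f_1(y)-\xi,u-y\rangle+\frac1\lambda D_h(u,y)\}$. BPDCAe: choose $x^0=x^{-1}\in C$, $\theta_{-1}=\theta_0=1$,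 $0<\lambda<1/L$, and $\rho$. For $k=0,1,2,\dots$: take any $\xi^k\in\partial_{\mathrm c}f_2(x^k)$; compute $\beta_k=\frac{\theta_{k-1}-1}{\theta_k}$ with $\theta_{k+1}=\frac{1+\sqrt{1+4\theta_k^2}}2$, and $y^k=x^k+\beta_k(x^k-x^{k-1})$; if $y^k\notin C$ or $D_h(x^k,y^k)>\rho D_h(x^{k-1},x^k)$ (adaptive restart), set $\beta_k=0$ with $\theta_{k-1}=\theta_k=1$; then compute $y^k=x^k+\beta_k(x^k-x^{k-1})$ and let $x^{k+1}$ be a minimizer over $y\in\overline{C}$ of $g(y)+\langle\nabla f_1(y^k)-\xi^k,y-y^k\rangle+\frac1\lambda D_h(y,y^k)$. One has $\beta_k\in[0,1)$. (The $\theta_k$ here are unrelated to the exponent $\theta$ in the claim.) When $C=\mathbb{R}^d$: $\tilde x$ is a limiting critical point of $(\mathcal{P})$ if $0\in\nabla f_1(\tilde x)-\partial_{\mathrm c}f_2(\tilde x)+\partial g(\tilde x)$; the set of these is $\mathcal{X}$. $\partial(\nabla h)(x)$ denotes the generalized (Clarke) Jacobian of the mapping $\nabla h$ at $x$, a set of $d\times d$ matrices equal to $\{\nabla^2h(x)\}$ when $h$ is $\mathcal{C}^2$ near $x$; hypothesis (f) says that on any bounded set there are elements of $\partial(\nabla h)(x)$ that are uniformly bounded in $x$. KL property (for functions on $\mathbb{R}^n$): for $\eta>0$, $\Xi_\eta$ is the set of continuous concave $\phi:[0,\eta)\to\mathbb{R}_+$, $\mathcal{C}^1$ on $(0,\eta)$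 with positive derivative, $\phi(0)=0$. A proper lower semicontinuous $f$ has the KL property at $\hat z\in\operatorname{dom}\partial f$ if there are $\eta\in(0,+\infty]$, a neighborhood $U$ of $\hat z$ and $\phi\in\Xi_\eta$ such that the KL inequality $\phi'(f(z)-f(\hat z))\cdot\operatorname{dist}(0,\partial f(z))\ge 1$ holds for all $z\in U$ with $f(\hat z)<f(z)<f(\hat z)+\eta$. $f$ is a KL function if it has the KL property at each point of $\operatorname{dom}\partial f$. *)

(* Defs.v *)
From HB Require Import structures.
From mathcomp Require Import all_boot all_order all_algebra.
From mathcomp Require Import all_classical all_reals all_analysis.

Set Implicit Arguments.
Unset Strict Implicit.
Unset Printing Implicit Defensive.

Import Order.TTheory GRing.Theory Num.Theory.
Import numFieldNormedType.Exports.

Local Open Scope classical_set_scope.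
Local Open Scope ring_scope.

(* R^n is 'rV[R]_n. The library norm `|x| on it is the max norm, hence the
   explicit Euclidean norm below; topology, boundedness and (local) Lipschitz
   continuity do not depend on the choice and are the library's. *)

Definition dotv (R : realType) (n : nat) (u v : 'rV[R]_n) : R :=
  \sum_(i < n) u 0 i * v 0 i.

Definition enorm (R : realType) (n : nat) (u : 'rV[R]_n) : R :=
  Num.sqrt (dotv u u).

Section ExtendedValued.
Context {R : realType} {n : nat}.
Implicit Types (f h : 'rV[R]_n -> \bar R) (x y : 'rV[R]_n) (A : set 'rV[R]_n).
Local Open Scope ereal_scope.

Definition edom f : set 'rV[R]_n := [set x | f x < +oo].

Definition proper_fun f : Prop :=
  (forall x, -oo < f x) /\ edom f !=set0.

Definition econvex_on A f : Prop :=
  forall x y (t : R), A x -> A y -> (0 <= t <= 1)%R ->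
    f (t *: x + (1 - t) *: y)%R <= t%:E * f x + (1 - t)%:E * f y.

Definition econvex f : Prop := econvex_on setT f.

Definition strongly_convex (sigma : R) f : Prop :=
  econvex (fun x => f x - (sigma / 2 * enorm x ^+ 2)%:E).

Definition grad f x : 'rV[R]_n :=
  \row_(i < n) 'D_(delta_mx 0%R i) (fine \o f) x.

(* Intended for open A: finiteness on A makes [fine \o f] agree with f near
   every point of A. *)
Definition C1_on A f : Prop :=
  (forall x, A x -> f x \is a fin_num) /\
  (forall x, A x -> differentiable (fine \o f) x) /\
  (forall x, A x -> {for x, continuous (grad f)}).

Definition convex_subdiff f x : set 'rV[R]_n :=
  [set xi | forall y, 0 <= f y - f x - (dotv xi (y - x)%R)%:E].

Definition frechet_subdiff f x : set 'rV[R]_n :=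
  [set xi | f x < +oo /\
    0 <= limf_einf (fun y => (f y - f x - (dotv xi (y - x)%R)%:E)
                             * ((enorm (y - x)%R)^-1)%:E) x^'].

Definition limiting_subdiff f x : set 'rV[R]_n :=
  [set xi | f x < +oo /\
    exists xs xis : nat -> 'rV[R]_n,
      [/\ xs @ \oo --> x,
          (fun k => f (xs k)) @ \oo --> f x,
          xis @ \oo --> xi
        & forall k, frechet_subdiff f (xs k) (xis k)]].

Definition dom_subdiff f : set 'rV[R]_n :=
  [set x | limiting_subdiff f x !=set0].

Definition supercoercive f : Prop :=
  forall B : R, exists r : R, (0 < r)%R /\
    forall u, (r <= enorm u)%R -> B%:E <= f u * ((enorm u)^-1)%:E.

Definition argmin_on A f : set 'rV[R]_n :=
  [set u | A u /\ forall v, A v -> f u <= f v].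

Definition level_bounded f : Prop :=
  forall r : R, bounded_set [set x | f x <= r%:E].

(* dist(0, A), equal to +oo when A is empty. *)
Definition dist0 A : \bar R := ereal_inf [set (enorm v)%:E | v in A].

End ExtendedValued.

Section LipschitzJacobian.
Context {R : realType} {n : nat}.
Implicit Types (F : 'rV[R]_n -> 'rV[R]_n) (A : set 'rV[R]_n).

Definition lipschitz_on_bounded F : Prop :=
  forall A, bounded_set A -> [lipschitz F x | x in A].

Definition locally_lipschitz_on A F : Prop :=
  forall x, A x -> exists2 V, nbhs x V & [lipschitz F z | z in V `&` A].

(* ['J F x] acts on row vectors from the right, so it is the transpose of the
   usual Jacobian; this is immaterial for F = grad h, whose Jacobians are
   symmetric. *)
Definition clarke_jacobian F (x : 'rV[R]_n) : set 'M[R]_n :=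
  smallest (@convex_set R 'M[R]_n)
    [set J | exists xs : nat -> 'rV[R]_n,
       [/\ xs @ \oo --> x,
           (forall k, differentiable F (xs k))
         & (fun k => 'J F (xs k)) @ \oo --> J]].

End LipschitzJacobian.

Section Bregman.
Context {R : realType} {d : nat}.
Implicit Types (C : set 'rV[R]_d) (f h g : 'rV[R]_d -> \bar R).
Local Open Scope ereal_scope.

Definition kernel_gen_dist C h : Prop :=
  [/\ proper_fun h, lower_semicontinuous h & econvex h] /\
  [/\ edom h `<=` closure C, dom_subdiff h = C, interior (edom h) = C
    & C1_on C h].

Definition bregman h (x y : 'rV[R]_d) : \bar R :=
  h x - h y - (dotv (grad h y) (x - y)%R)%:E.

Definition smad C f h (L : R) : Prop :=
  [/\ (0 < L)%R, kernel_gen_dist C h, proper_fun f & lower_semicontinuous f] /\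
  [/\ edom h `<=` edom f, C1_on C f,
      econvex_on C (fun x => L%:E * h x - f x)
    & econvex_on C (fun x => L%:E * h x + f x)].

Definition objective f1 f2 g (x : 'rV[R]_d) : \bar R := f1 x - f2 x + g x.

Record basic_assumptions C f1 f2 g h : Prop := BasicAssumptions {
  ba_kernel : kernel_gen_dist C h;
  ba_closure : closure C = closure (edom h);
  ba_f1_proper : proper_fun f1;
  ba_f1_convex : econvex f1;
  ba_f1_dom : edom h `<=` edom (fun x => f1 x + g x);
  ba_f1_C1 : C1_on C f1;
  ba_f2_proper : proper_fun f2;
  ba_f2_convex : econvex f2;
  ba_g_proper : proper_fun g;
  ba_g_lsc : lower_semicontinuous g;
  ba_g_dom : edom g `&` C !=set0;
  ba_bounded_below : -oo < ereal_inf (objective f1 f2 g @` closure C);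
  ba_supercoercive : forall lam : R, (0 < lam)%R ->
    supercoercive (fun u => lam%:E * g u + h u)
}.

(* The set S_lam(x, y) built with the subgradient xi of f2 at x; x enters only
   through xi. *)
Definition subproblem C f1 g h (lam : R) (y xi : 'rV[R]_d) : set 'rV[R]_d :=
  argmin_on (closure C)
    (fun u => g u + (dotv (grad f1 y - xi) (u - y))%R%:E
              + (lam^-1)%:E * bregman h u y).

Definition extrapolate (t : R * R) (xprev x : 'rV[R]_d) : 'rV[R]_d :=
  (x + ((t.1 - 1) / t.2) *: (x - xprev))%R.

Definition restart C h (rho : R) (xprev x y : 'rV[R]_d) : Prop :=
  ~ C y \/ rho%:E * bregman h xprev x < bregman h x y.

(* x 0 = x^0 = x^{-1}, which is why the predecessor of x k is x k.-1 for all k.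
   t k is the pair (theta_{k-1}, theta_k) on entering iteration k, and t' the
   pair after the restart test; with t' = (1, 1) the coefficient beta_k is 0.
   The recursion for theta_{k+1} uses the value of theta_k after the test. *)
Definition BPDCAe C f1 f2 g h (lam rho : R) (x : nat -> 'rV[R]_d) : Prop :=
  C (x 0%N) /\
  exists (xi y : nat -> 'rV[R]_d) (t : nat -> R * R),
    t 0%N = (1, 1)%R /\
    forall k : nat,
      let t' := if `[< restart C h rho (x k.-1) (x k)
                         (extrapolate (t k) (x k.-1) (x k)) >]
                then (1, 1)%R else t k in
      [/\ convex_subdiff f2 (x k) (xi k),
          y k = extrapolate t' (x k.-1) (x k),
          t k.+1 = (t'.2, (1 + Num.sqrt (1 + 4 * t'.2 ^+ 2)) / 2)%R
        & subproblem C f1 g h lam (y k) (xi k) (x k.+1)].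

Definition limiting_critical f1 f2 g : set 'rV[R]_d :=
  [set x | exists xi zeta : 'rV[R]_d,
     [/\ convex_subdiff f2 x xi, limiting_subdiff g x zeta
       & (grad f1 x - xi + zeta = 0)%R]].

(* H_M(x, y) = Psi(x) + M D_h(y, x), with z = (x, y) in R^d x R^d = R^(d + d). *)
Definition auxiliary f1 f2 g h (M : R) (z : 'rV[R]_(d + d)) : \bar R :=
  objective f1 f2 g (lsubmx z) + M%:E * bregman h (rsubmx z) (lsubmx z).

End Bregman.

Section KurdykaLojasiewicz.
Context {R : realType} {n : nat}.
Implicit Types (f : 'rV[R]_n -> \bar R) (phi : R -> R) (eta : \bar R).
Local Open Scope ereal_scope.

Definition desingularizing eta phi : Prop :=
  let I := [set s : R | (0 <= s)%R /\ s%:E < eta] in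
  [/\ phi 0%R = 0%R,
      (forall s, I s -> (0 <= phi s)%R),
      {within I, continuous phi},
      (forall s t a : R, I s -> I t -> (0 <= a <= 1)%R ->
         (a * phi s + (1 - a) * phi t <= phi (a * s + (1 - a) * t))%R)
    & forall s : R, (0 < s)%R -> s%:E < eta ->
        [/\ derivable phi s 1, {for s, continuous (derive1 phi)}
          & (0 < derive1 phi s)%R]].

(* The KL property at zh with a desingularizing function taken in Phi. *)
Definition KL_property_with (Phi : set (R -> R)) f (zh : 'rV[R]_n) : Prop :=
  exists (eta : \bar R) (U : set 'rV[R]_n) (phi : R -> R),
    [/\ 0 < eta, nbhs zh U, desingularizing eta phi, Phi phi
      & forall z, U z -> f zh < f z -> f z < f zh + eta ->
          1 <= (derive1 phi (fine (f z) - fine (f zh))%R)%:E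
               * dist0 (limiting_subdiff f z)].

Definition KL_function_with (Phi : set (R -> R)) f : Prop :=
  [/\ proper_fun f, lower_semicontinuous f
    & forall z, dom_subdiff f z -> KL_property_with Phi f z].

End KurdykaLojasiewicz.

Definition power_desingularizing (R : realType) (theta : R) : set (R -> R) :=
  [set phi | exists2 c : R, 0 < c & phi = (fun s => c * s `^ (1 - theta))].

(* Main.v *)
(* The domain hypotheses force C = R^d and make f1, f2, g, h finite. Convexity of
   g gives a three-point inequality for the subproblem, and with the restart test
   V_k = H_M(x^{k+1}, x^k) satisfies
     V_{k+1} + (M - rho/lam) D_k + (1/lam - M) D_{k+1} <= V_k,
   where D_k = D_h(x^k, x^{k+1}) dominates delta_k^2 = |x^{k+1} - x^k|^2.

   D_h(y, .) is only locally Lipschitz, so no sum rule yields an explicit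
   subgradient of H_M. Instead H_M is bounded below near z = (x^{k+1}, x^k) by
   H_M(z) - l |. - z| up to a quadratic error, with
   l = O(delta_k + delta_{k-1}); minimising a quadratic penalisation of a lower
   semicontinuous function with this property produces limiting subgradients of
   norm at most 2 l.

   With s_k = V_k - lim V the KL inequality becomes
   s_k^theta <= K (delta_k + delta_{k-1}), and the rates follow from this and the
   decrease by a telescoping argument on s_k^(1 - theta). *)

Require Import Defs.
From HB Require Import structures.
From mathcomp Require Import all_boot all_order all_algebra.
From mathcomp Require Import all_classical all_reals all_analysis.
From mathcomp Require Import ring lra zify.

Set Implicit Arguments.
Unset Strict Implicit.
Unset Printing Implicit Defensive.

Import Order.TTheory GRing.Theory Num.Theory.
Import numFieldNormedType.Exports.

Local Open Scope classical_set_scope.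
Local Open Scope ring_scope.

(** * Euclidean norm *)

(** Either of the coefficients M - rho/lam and 1/lam - M may vanish; only their sum (1 - rho)/lam is
    known to be positive. A single descent inequality therefore need not control any step, and three
    consecutive ones are added to obtain the factor (1 - rho)/lam on D_{k+1} + D_{k+2}. This is the
    source of the shift from s_k to s_{k+3} and of the unit e_k = delta_k + delta_{k+1}, which also
    bounds the subgradients. The KL inequality is used at (xt, xt), so V_k must tend to H_M(xt, xt)
    and that point must carry a limiting subgradient. Both rest on the subgradients zeta_k of g read
    off the subproblem: they converge, their limit is a subgradient of g at xt, and their inequality
    tested at xt gives g(x^k) -> g(xt). The term -f2 is concave, but near xt it stays above its
    linearisation up to a quadratic error because grad f2 is Lipschitz there; this is the kind of
    error that the slope bound on H_M tolerates. *)

Section Euclidean.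
Context {R : realType} {n : nat}.
Implicit Types (u v w : 'rV[R]_n) (a : R).

Lemma dotvC u v : dotv u v = dotv v u.
Proof. by apply: eq_bigr => i _; rewrite mulrC. Qed.

Lemma dotvDl u v w : dotv (u + v) w = dotv u w + dotv v w.
Proof. by rewrite -big_split; apply: eq_bigr => i _; rewrite mxE mulrDl. Qed.

Lemma dotvZl a u v : dotv (a *: u) v = a * dotv u v.
Proof. by rewrite mulr_sumr; apply: eq_bigr => i _; rewrite mxE mulrA. Qed.

Lemma dotvNl u v : dotv (- u) v = - dotv u v.
Proof. by rewrite -scaleN1r dotvZl mulN1r. Qed.

Lemma dotvBl u v w : dotv (u - v) w = dotv u w - dotv v w.
Proof. by rewrite dotvDl dotvNl. Qed.

Lemma dotvDr u v w : dotv w (u + v) = dotv w u + dotv w v.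
Proof. by rewrite dotvC dotvDl !(dotvC w). Qed.

Lemma dotvZr a u v : dotv v (a *: u) = a * dotv v u.
Proof. by rewrite dotvC dotvZl (dotvC v). Qed.

Lemma dotvNr u v : dotv v (- u) = - dotv v u.
Proof. by rewrite dotvC dotvNl (dotvC v). Qed.

Lemma dotvBr u v w : dotv w (u - v) = dotv w u - dotv w v.
Proof. by rewrite dotvDr dotvNr. Qed.

Lemma dotv0 u : dotv u 0 = 0.
Proof. by rewrite -(subrr u) dotvBr subrr. Qed.

Lemma dotv_ge0 u : 0 <= dotv u u.
Proof. by apply: sumr_ge0 => i _; rewrite -expr2 sqr_ge0. Qed.

Lemma dotv_eq0 u : dotv u u = 0 -> u = 0.
Proof.
move=> /eqP; rewrite psumr_eq0 => [/allP u0|i _]; last by rewrite -expr2 sqr_ge0.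
apply/rowP => i; have := u0 i (mem_index_enum i).
by rewrite /= mulf_eq0 orbb mxE => /eqP.
Qed.

Lemma enorm_ge0 u : 0 <= enorm u.
Proof. exact: sqrtr_ge0. Qed.

Lemma enorm_sqr u : enorm u ^+ 2 = dotv u u.
Proof. by rewrite sqr_sqrtr ?dotv_ge0. Qed.

Lemma enorm0 : enorm (0 : 'rV[R]_n) = 0.
Proof. by rewrite /enorm dotv0 sqrtr0. Qed.

Lemma enormZ a u : enorm (a *: u) = `|a| * enorm u.
Proof.
by rewrite /enorm dotvZl dotvZr mulrA -expr2 sqrtrM ?sqr_ge0// sqrtr_sqr.
Qed.

Lemma enormN u : enorm (- u) = enorm u.
Proof. by rewrite -scaleN1r enormZ normrN1 mul1r. Qed.

Lemma enormBC u v : enorm (u - v) = enorm (v - u).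
Proof. by rewrite -enormN opprB. Qed.

(** Cauchy-Schwarz, from the nonnegative squared norm of |v| u - |u| v. *)
Lemma dotv_le u v : dotv u v <= enorm u * enorm v.
Proof.
have [v0|v0] := eqVneq (enorm v) 0.
  have /dotv_eq0 -> : dotv v v = 0 by rewrite -enorm_sqr v0 expr0n.
  by rewrite dotv0 enorm0 mulr0.
have vp : 0 < enorm v by rewrite lt_neqAle eq_sym v0 enorm_ge0.
have [u0|u0] := eqVneq (enorm u) 0.
  have /dotv_eq0 -> : dotv u u = 0 by rewrite -enorm_sqr u0 expr0n.
  by rewrite dotvC dotv0 enorm0 mul0r.
have up : 0 < enorm u by rewrite lt_neqAle eq_sym u0 enorm_ge0.
have := dotv_ge0 (enorm v *: u - enorm u *: v).
rewrite dotvBl !dotvBr !dotvZl !dotvZr -!enorm_sqr (dotvC v u) => h.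
have : 0 <= 2 * (enorm u * enorm v) * (enorm u * enorm v - dotv u v) by lra.
by rewrite pmulr_rge0 ?subr_ge0// !mulr_gt0.
Qed.

Lemma dotv_ge u v : - (enorm u * enorm v) <= dotv u v.
Proof. by rewrite -[dotv u v]opprK lerN2 -dotvNl -(enormN u) dotv_le. Qed.

Lemma enormD u v : enorm (u + v) <= enorm u + enorm v.
Proof.
rewrite -(@ler_pXn2r _ 2)// ?nnegrE ?addr_ge0 ?enorm_ge0//.
rewrite enorm_sqr dotvDl !dotvDr -!enorm_sqr (dotvC v u).
by have := dotv_le u v; lra.
Qed.

Lemma enormB_le u v w : enorm (u - w) <= enorm (u - v) + enorm (v - w).
Proof. by rewrite -[u - w](subrKA v) enormD. Qed.

Lemma norm_le_enorm u : `|u| <= enorm u.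
Proof.
rewrite [leLHS]/Num.norm/= mx_normrE; apply/bigmax_leP; split=> [|[i j] _ /=].
  exact: enorm_ge0.
rewrite ord1 -(@ler_pXn2r _ 2)// ?nnegrE ?normr_ge0 ?enorm_ge0//.
rewrite enorm_sqr /dotv (bigD1 j)//= real_normK ?num_real// expr2 lerDl.
by apply: sumr_ge0 => k _; rewrite -expr2 sqr_ge0.
Qed.

Lemma enorm_le_norm u : enorm u <= Num.sqrt n%:R * `|u|.
Proof.
rewrite -(@ler_pXn2r _ 2)// ?nnegrE ?mulr_ge0 ?sqrtr_ge0 ?enorm_ge0//.
rewrite enorm_sqr exprMn sqr_sqrtr// mulr_natl -[X in _ *+ X]card_ord -sumr_const.
apply: ler_sum => i _; rewrite -expr2 -[leLHS]real_normK ?num_real//.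
rewrite ler_pXn2r ?nnegrE ?normr_ge0//.
rewrite [leRHS]/Num.norm/= mx_normrE; apply/bigmax_geP; right.
by exists (0, i).
Qed.

Lemma nbhs_enorm (x : 'rV[R]_n) (V : set 'rV[R]_n) : nbhs x V ->
  exists2 r, 0 < r & forall y, enorm (y - x) <= r -> V y.
Proof.
move=> /nbhs_ballP[e /= e0 eV]; exists (e / 2) => [|y yx]; first by rewrite divr_gt0.
apply: eV; rewrite -ball_normE /ball_/= distrC (le_lt_trans (norm_le_enorm _))//.
by rewrite (le_lt_trans yx)// ltr_pdivrMr//; lra.
Qed.

Lemma enorm_ball_nbhs (x : 'rV[R]_n) (r : R) : 0 < r ->
  nbhs x [set y | enorm (y - x) < r].
Proof.
move=> r0; have s0 := sqrtr_ge0 (n%:R : R).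
apply/nbhs_ballP; exists (r / (Num.sqrt n%:R + 1)) => [|y].
  by rewrite /= divr_gt0// ltr_pwDr.
rewrite -ball_normE /ball_/= distrC => yx.
rewrite (le_lt_trans (enorm_le_norm _))//.
rewrite ltr_pdivlMr ?ltr_pwDr// in yx.
by have := normr_ge0 (y - x); lra.
Qed.

Lemma cvg_enorm (x : nat -> 'rV[R]_n) (l : 'rV[R]_n) :
  x @ \oo --> l <->
  forall e, 0 < e -> \forall k \near \oo, enorm (x k - l) < e.
Proof.
split=> [xl e e0|h V /nbhs_enorm[r r0 rV]].
  by have := xl _ (enorm_ball_nbhs l e0).
by apply: filterS (h r r0) => k /ltW/rV.
Qed.

Lemma cvg_enorm_norm (x : nat -> 'rV[R]_n) (l : 'rV[R]_n) :
  x @ \oo --> l -> (fun k => enorm (x k - l)) @ \oo --> (0 : R).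
Proof.
move=> /cvg_enorm xl; apply/cvgrPdist_lt => e e0.
by apply: filterS (xl e e0) => k; rewrite sub0r normrN ger0_norm ?enorm_ge0.
Qed.

Lemma compact_enorm_ball (x : 'rV[R]_n) (r : R) :
  compact [set y | enorm (y - x) <= r].
Proof.
apply: bounded_closed_compact.
  exists (r + `|x|); split; first exact: num_real.
  move=> M rM y /= yx; apply: le_trans (ltW rM).
  rewrite -[y in leLHS](subrK x) (le_trans (ler_normD _ _))// lerD2r.
  exact: le_trans (norm_le_enorm _) yx.
move=> y clA /=; apply/ler_addgt0Pr => e e0.
have [z [/= zx zy]] := clA _ (enorm_ball_nbhs y e0).
rewrite (le_trans (enormB_le _ z _))// addrC lerD// enormBC ltW//.
Qed.

End Euclidean.

Lemma enorm_submx_sqr (R : realType) (d : nat) (z : 'rV[R]_(d + d)) :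
  enorm z ^+ 2 = enorm (lsubmx z) ^+ 2 + enorm (rsubmx z) ^+ 2.
Proof.
rewrite !enorm_sqr /dotv big_split_ord/=; congr (_ + _).
  by apply: eq_bigr => i _; rewrite !mxE.
by apply: eq_bigr => i _; rewrite !mxE.
Qed.

(** * First-order inequalities *)

(** Common source of the first-order inequalities below: each is an upper bound along a segment,
    differentiated at its starting point. The term in [B] leaves room for a quadratic remainder, as
    in strong convexity. *)
Lemma diff_le (R : realType) (n : nat) (P : 'rV[R]_n -> R) (x v : 'rV[R]_n)
    (A B : R) : differentiable P x ->
  (forall t : R, 0 < t <= 1 -> P (x + t *: v) <= P x + t * A + t ^+ 2 * B) ->
  'd P x v <= A.
Proof.
move=> dP PAB; rewrite leNgt; apply/negP => Alt.
have := @diff_derivable _ _ _ P x v dP.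
move=> /cvgrPdist_lt.
rewrite -deriveE// in Alt.
rewrite -/(derive P x v).
set D := 'D_v P x in Alt *.
have e0 : 0 < (D - A) / 2 by lra.
move=> /(_ _ e0); rewrite -/D => -[r /= r0 rP].
(* The three bounds bring the difference quotient within (D - A)/2 of [D], make the hypothesis
   applicable, and give t B <= (D - A)/2. *)
pose t := Num.min (r / 2) (Num.min 1 ((D - A) / (2 * (`|B| + 1)))).
have B0 : 0 < `|B| + 1 by rewrite ltr_wpDl.
have t0 : 0 < t by rewrite !lt_min ltr01 !divr_gt0 ?subr_gt0 ?mulr_gt0.
have t1 : t <= 1 by rewrite !ge_min lexx orbT.
have tr : t < r.
  have : t <= r / 2 by rewrite ge_min lexx.
  lra.
have tB : t * B <= (D - A) / 2.
  have : t <= (D - A) / (2 * (`|B| + 1)) by rewrite !ge_min lexx !orbT.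
  rewrite ler_pdivlMr ?mulr_gt0// => h.
  have : t * B <= t * (`|B| + 1).
    by rewrite ler_pM2l//; have := ler_norm B; lra.
  lra.
have := rP t; rewrite /ball_/= sub0r normrN gtr0_norm// => /(_ tr).
rewrite gt_eqF// => /(_ isT).
rewrite ltr_norml => /andP[_]; rewrite (addrC _ x).
have := PAB t; rewrite t0 t1 => /(_ isT).
rewrite -subr_ge0 => h.
have : t^-1 *: (P (x + t *: v) - P x) <= A + t * B.
  rewrite /GRing.scale/= mulrC ler_pdivrMr//; lra.
by rewrite -/D; lra.
Qed.

Lemma diff_grad (R : realType) (n : nat) (P : 'rV[R]_n -> R) (x v : 'rV[R]_n) :
  differentiable P x -> 'd P x v = dotv (grad (EFin \o P) x) v.
Proof.
move=> dP; rewrite {1}(row_sum_delta v) linear_sum; apply: eq_bigr => i _.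
by rewrite linearZ/= mxE deriveE// mulrC.
Qed.

Lemma grad_le (R : realType) (n : nat) (P : 'rV[R]_n -> R) (x v : 'rV[R]_n)
    (A B : R) : differentiable P x ->
  (forall t : R, 0 < t <= 1 -> P (x + t *: v) <= P x + t * A + t ^+ 2 * B) ->
  dotv (grad (EFin \o P) x) v <= A.
Proof. by move=> dP /(diff_le dP); rewrite diff_grad. Qed.

Lemma convex_grad (R : realType) (n : nat) (P : 'rV[R]_n -> R) (x y : 'rV[R]_n) :
  differentiable P x ->
  (forall t : R, 0 <= t <= 1 ->
     P (t *: y + (1 - t) *: x) <= t * P y + (1 - t) * P x) ->
  dotv (grad (EFin \o P) x) (y - x) <= P y - P x.
Proof.
move=> dP cP; apply: (@grad_le _ _ _ _ _ _ 0) => // t /andP[t0 t1].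
have -> : x + t *: (y - x) = t *: y + (1 - t) *: x.
  by rewrite scalerBr scalerBl scale1r addrCA.
by have := cP t; rewrite (ltW t0) t1 => /(_ isT); lra.
Qed.

(** A quadratic error divided by |y - x| tends to 0, so it is invisible to the lower limit. *)
Lemma frechet_quadratic (R : realType) (n : nat) (F : 'rV[R]_n -> R)
    (x xi : 'rV[R]_n) (c r : R) : 0 <= c -> 0 < r ->
  (forall y, enorm (y - x) <= r ->
     - c * enorm (y - x) ^+ 2 <= F y - F x - dotv xi (y - x)) ->
  frechet_subdiff (EFin \o F) x xi.
Proof.
move=> c0 r0 H; split; first exact: ltry.
rewrite limf_einfE; apply/lee_addgt0Pr => e e0.
rewrite -leeBlDr// sub0e.
pose s := Num.min r (e / (c + 1)).
have c10 : 0 < c + 1 by rewrite ltr_wpDl.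
have s0 : 0 < s by rewrite lt_min r0 divr_gt0.
pose V := [set y : 'rV[R]_n | enorm (y - x) < s /\ y != x].
apply: ereal_sup_ge.
exists (ereal_inf ((fun y => (((EFin \o F) y - (EFin \o F) x - (dotv xi (y - x)%R)%:E)
                             * ((enorm (y - x)%R)^-1)%:E)%E) @` V)).
  exists V => //.
  have := enorm_ball_nbhs x s0.
  by apply: (@filterS _ (nbhs x)) => y ys yx; split.
apply: le_ereal_inf_tmp => _ [y [ys yx] <-].
have N0 : 0 < enorm (y - x).
  rewrite lt_neqAle enorm_ge0 eq_sym andbT; apply: contra yx => /eqP h.
  by rewrite -subr_eq0; apply/eqP/dotv_eq0; rewrite -enorm_sqr h expr0n.
rewrite -!EFinB -EFinM -EFinN lee_fin ler_pdivlMr//.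
have yr : enorm (y - x) <= r.
  by rewrite (le_trans (ltW ys))// ge_min lexx.
apply: le_trans (H _ yr).
rewrite expr2 mulrA ler_pM2r// mulNr lerN2.
have : enorm (y - x) * (c + 1) <= e.
  by rewrite -ler_pdivlMr// (le_trans (ltW ys))// ge_min lexx orbT.
by have := enorm_ge0 (y - x); lra.
Qed.

(** * Limiting subgradients from a slope bound *)

(** The bound [b] makes the infimum a real number. A minimising sequence clusters at some [p]; were
    [G p] above the infimum, [G] would exceed their midpoint near [p], while the tail of the
    sequence lies below it. *)
Lemma lsc_compact_min (R : realType) (n : nat) (G : 'rV[R]_n -> R)
    (K : set 'rV[R]_n) (b : R) : compact K -> K !=set0 ->
  (forall y, K y -> b <= G y) ->
  (forall x a, a < G x -> \forall y \near x, a < G y) ->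
  exists2 p, K p & forall y, K y -> G p <= G y.
Proof.
move=> cK [k0 Kk0] bG lscG.
pose S := [set G y | y in K].
have lS : has_lbound S by exists b => _ [y Ky <-]; exact: bG.
have iS : has_inf S by split=> //; exists (G k0), k0.
have infS y : K y -> inf S <= G y by move=> Ky; apply: ge_inf => //; exists y.
have /choice[u uP] : forall i : nat, exists y, K y /\ G y < inf S + i.+1%:R^-1.
  move=> i; have i0 : (0 : R) < i.+1%:R^-1 by rewrite invr_gt0.
  by have [_ [y Ky <-] h] := inf_adherent i0 iS; exists y.
have uK : (u @ \oo) K by exists 0%N => // i _; exact: (uP i).1.
have [p [Kp clp]] := cK _ _ uK.
exists p => // y Ky; apply: le_trans (infS _ Ky).
rewrite leNgt; apply/negP => mp.
have e0 : 0 < (G p - inf S) / 2 by lra.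
have [N _ NP] := near_infty_natSinv_lt (PosNum e0).
have := lscG p ((G p + inf S) / 2).
rewrite (_ : _ < G p); last by lra.
move=> /(_ isT) nB.
have uA : (u @ \oo) [set y | G y < (G p + inf S) / 2].
  exists N => // i /NP /=; rewrite -(ltrD2l (inf S)) => iN.
  by rewrite (_ : (G p + inf S) / 2 = inf S + (G p - inf S) / 2); [exact: lt_trans (uP i).2 _|lra].
have [z [/= z1 z2]] := clp _ _ uA nB.
by have := lt_trans z1 z2; rewrite ltxx.
Qed.

Lemma dotv_diff_sqr (R : realType) (n : nat) (x y z : 'rV[R]_n) :
  enorm (y - z) ^+ 2 =
  enorm (x - z) ^+ 2 + 2 * dotv (x - z) (y - x) + enorm (y - x) ^+ 2.
Proof.
rewrite !enorm_sqr !dotvBl !dotvBr (dotvC y x) (dotvC z x) (dotvC z y).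
by ring.
Qed.

(* Minimising [F + j/2 |. - z|^2] over the ball yields points near [z] whose
   Frechet subgradients [-j (z_j - z)] are bounded by [2 l]. *)
Lemma slope_frechet (R : realType) (n : nat) (F : 'rV[R]_n -> R)
    (z : 'rV[R]_n) (l r j : R) :
  lower_semicontinuous (EFin \o F) -> 0 <= l -> 0 < r -> 0 < j -> 2 * l < r * j ->
  (forall y, enorm (y - z) <= r -> F z - l * enorm (y - z) <= F y) ->
  exists zj xi, [/\ enorm (zj - z) <= 2 * l / j, F zj <= F z,
    F z - 2 * l ^+ 2 / j <= F zj, enorm xi <= 2 * l
    & frechet_subdiff (EFin \o F) zj xi].
Proof.
move=> lscF l0 r0 j0 lrj slope.
pose q y := enorm (y - z) ^+ 2.
pose G y := F y + j / 2 * q y.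
have [p /= Kp pmin] : exists2 p, enorm (p - z) <= r &
    forall y, enorm (y - z) <= r -> G p <= G y.
  apply: (@lsc_compact_min _ _ G [set y | enorm (y - z) <= r] (F z - l * r)).
  - exact: compact_enorm_ball.
  - by exists z; rewrite /= subrr enorm0 ltW.
  - move=> y /= yr; apply: le_trans (_ : F y <= _); last first.
      by rewrite lerDl mulr_ge0 ?sqr_ge0 ?divr_ge0 ?ltW.
    apply: le_trans (slope _ yr); rewrite lerD2l lerN2.
    by rewrite ler_wpM2l.
  move=> x a aG.
  (* One half of the gap is granted to [F], the other to the quadratic term. *)
  pose e := (G x - a) / 2.
  have e0 : 0 < e by rewrite /e; lra.
  have [V nV VP] : exists2 V, nbhs x V & forall y, V y -> F x - e < F y.
    have [|V nV VP] := lscF x (F x - e); first by rewrite lte_fin; lra.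
    by exists V => // y /VP; rewrite lte_fin.
  pose s := Num.min 1 (e / (j * (enorm (x - z) + 1))).
  have h0 : 0 < j * (enorm (x - z) + 1) by rewrite mulr_gt0// ltr_wpDl ?enorm_ge0.
  have s0 : 0 < s by rewrite lt_min ltr01 divr_gt0.
  apply: filterS2 nV (enorm_ball_nbhs x s0) => y Vy /= yx.
  have Fy := VP _ Vy.
  have : q x - q y <= 2 * enorm (x - z) * enorm (y - x).
    rewrite /q (dotv_diff_sqr x y z).
    by have := dotv_ge (x - z) (y - x); have := sqr_ge0 (enorm (y - x)); lra.
  have : enorm (y - x) * (j * (enorm (x - z) + 1)) <= e.
    by rewrite -ler_pdivlMr// (le_trans (ltW yx))// ge_min lexx orbT.
  rewrite mulrDr mulr1 mulrDr => h1 h2.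
  have h3 : 0 <= enorm (y - x) * j by rewrite mulr_ge0 ?enorm_ge0 ?ltW.
  have : j / 2 * (q x - q y) <= e.
    apply: le_trans (_ : j / 2 * (2 * enorm (x - z) * enorm (y - x)) <= _).
      by rewrite ler_pM2l// divr_gt0.
    lra.
  rewrite /e /G in aG Fy * => h4; lra.
have Gz : G z = F z by rewrite /G /q subrr enorm0 expr0n mulr0 addr0.
have pz := pmin z; rewrite subrr enorm0 (ltW r0) Gz in pz.
have {}pz := pz isT.
have sp := slope _ Kp.
have N0 := enorm_ge0 (p - z).
(* Comparing the values of [G] at [p] and [z] gives j/2 |p - z|^2 <= F z - F p <= l |p - z|; the
   factor 2 arises here. *)
have jN : j * enorm (p - z) <= 2 * l.
  have [->|Np] := eqVneq (enorm (p - z)) 0; first by rewrite mulr0 mulr_ge0.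
  have {}Np : 0 < enorm (p - z) by rewrite lt_neqAle eq_sym Np.
  have : enorm (p - z) * (j * enorm (p - z)) <= enorm (p - z) * (2 * l).
    by rewrite /G /q in pz; lra.
  by rewrite ler_pM2l.
have pl : enorm (p - z) <= 2 * l / j by rewrite ler_pdivlMr// mulrC.
exists p, (- j *: (p - z)); split => //.
- by apply: le_trans pz; rewrite lerDl mulr_ge0 ?sqr_ge0 ?divr_ge0 ?ltW.
- apply: le_trans sp; rewrite lerD2l lerN2.
  have := ler_wpM2l l0 pl; rewrite expr2; lra.
- by rewrite enormZ normrN gtr0_norm.
(* The condition 2 l < r j keeps [p] inside the ball, so [p] is a local minimiser of [G]; expanding
   the quadratic term about [p] leaves the error j/2 |y - p|^2. *)
have r'0 : 0 < r - enorm (p - z).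
  rewrite subr_gt0 (le_lt_trans pl)// ltr_pdivrMr//.
apply: (@frechet_quadratic _ _ _ _ _ (j / 2) _ _ r'0); first by rewrite divr_ge0 ?ltW.
move=> y yp.
have yz : enorm (y - z) <= r.
  by apply: (le_trans (enormB_le _ p _)); lra.
have := pmin _ yz; rewrite /G /q (dotv_diff_sqr p y z) dotvZl.
lra.
Qed.

(** As the penalty [J i] grows, the points and their values tend to [z] and [F z], while the Frechet
    subgradients stay in the compact ball of radius 2 l and hence cluster. *)
Lemma slope_limiting (R : realType) (n : nat) (F : 'rV[R]_n -> R)
    (z : 'rV[R]_n) (l r : R) :
  lower_semicontinuous (EFin \o F) -> 0 <= l -> 0 < r ->
  (forall y, enorm (y - z) <= r -> F z - l * enorm (y - z) <= F y) ->
  exists2 v, limiting_subdiff (EFin \o F) z v & enorm v <= 2 * l.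
Proof.
move=> lscF l0 r0 slope.
(* This offset makes the side condition 2 l < r J i hold for every [i]. *)
pose N : R := 2 * l / r + 1.
have N0 : 0 < N by rewrite /N ltr_wpDl// divr_ge0 ?mulr_ge0// ltW.
pose J (i : nat) := N + i.+1%:R.
have J0 i : 0 < J i by rewrite /J addr_gt0.
have Jk i : i.+1%:R <= J i by rewrite /J lerDr ltW.
have Jr i : 2 * l < r * J i.
  rewrite [r * _]mulrC -ltr_pdivrMr//.
  by rewrite /J /N -addrA ltrDl addr_gt0.
have /choice[w wP] : forall i, exists w : 'rV[R]_n * 'rV[R]_n,
  [/\ enorm (w.1 - z) <= 2 * l / J i, F w.1 <= F z,
    F z - 2 * l ^+ 2 / J i <= F w.1, enorm w.2 <= 2 * l
    & frechet_subdiff (EFin \o F) w.1 w.2].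
  move=> i; have [p [xi h]] := slope_frechet lscF l0 r0 (J0 i) (Jr i) slope.
  by exists (p, xi).
have wK : ((snd \o w) @ \oo) [set y | enorm (y - 0) <= 2 * l].
  by exists 0%N => // i _; rewrite /= subr0; have [] := wP i.
have [v [/= vK clv]] := compact_enorm_ball (_ : ProperFilter ((snd \o w) @ \oo)) wK.
rewrite subr0 in vK.
(* The selected indices need not increase: k <= i k already forces the penalties to infinity. *)
have /choice[i iP] : forall k : nat, exists i, (k <= i)%N /\
    enorm ((w i).2 - v) < k.+1%:R^-1.
  move=> k; have k0 : (0 : R) < k.+1%:R^-1 by rewrite invr_gt0.
  have kA : ((snd \o w) @ \oo) [set (w i).2 | i in [set i | (k <= i)%N]].
    by exists k => // i /= ki; exists i.
  have [_ [[i ki <-] h]] := clv _ _ kA (enorm_ball_nbhs v k0).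
  by exists i.
have small (c e : R) : 0 <= c -> 0 < e -> \forall k \near \oo, c / J (i k) < e.
  move=> c0 e0.
  have e'0 : 0 < e / (c + 1) by rewrite divr_gt0// ltr_wpDl.
  apply: filterS (near_infty_natSinv_lt (PosNum e'0)) => k /= ke.
  have c1 : 0 < c + 1 by rewrite ltr_wpDl.
  have kJ : k.+1%:R <= J (i k).
    by apply: le_trans (Jk _); rewrite ler_nat ltnS (iP k).1.
  have : (J (i k))^-1 <= k.+1%:R^-1 by rewrite lef_pV2 ?posrE.
  move=> /le_lt_trans/(_ ke); rewrite ltr_pdivlMr// => h.
  apply: le_lt_trans h; rewrite mulrC ler_wpM2l ?invr_ge0 ?(ltW (J0 _))//; lra.
exists v => //; split; first exact: ltry.
exists (fun k => (w (i k)).1), (fun k => (w (i k)).2); split.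
- apply/cvg_enorm => e e0.
  apply: filterS (small (2 * l) _ _ e0); last by rewrite mulr_ge0.
  by move=> k; apply: le_lt_trans; have [] := wP (i k).
- apply: cvg_EFin; first by exists 0%N.
  apply/cvgrPdist_lt => e e0.
  apply: filterS (small (2 * l ^+ 2) _ _ e0); last by rewrite mulr_ge0 ?sqr_ge0.
  move=> k; apply: le_lt_trans; have [_ h1 h2 _ _] := wP (i k).
  by rewrite /= ger0_norm; lra.
- apply/cvg_enorm => e e0.
  apply: filterS (near_infty_natSinv_lt (PosNum e0)) => k /=.
  exact: lt_trans (iP k).2.
- by move=> k; have [] := wP (i k).
Qed.

(** * Rates from abstract KL recursions *)

(** The tangent inequality of the concave s^(1 - theta) at [a], multiplied by a^theta so that a = 0
    is allowed. It is Young's inequality for b^(1 - theta) a^theta with exponents 1/(1 - theta) and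
    1/theta. *)
Lemma powR_tangent (R : realType) (a b theta : R) : 0 <= a -> 0 <= b ->
  0 < theta < 1 ->
  (1 - theta) * (a - b) <= a `^ theta * (a `^ (1 - theta) - b `^ (1 - theta)).
Proof.
move=> a0 b0 /andP[t0 t1].
have u0 : 0 < 1 - theta by lra.
have := @conjugate_powR _ (b `^ (1 - theta)) (a `^ theta) (1 - theta)^-1 theta^-1.
rewrite !powR_ge0 !invr_gt0 t0 u0 !invrK subrK -!powRrM.
rewrite !mulfV ?gt_eqF// !powRr1// => /(_ isT isT isT isT erefl) h.
have -> : a `^ theta * (a `^ (1 - theta) - b `^ (1 - theta)) =
    a - b `^ (1 - theta) * a `^ theta.
  rewrite mulrBr -powRD; last by rewrite subrKC oner_eq0.
  by rewrite subrKC powRr1// [a `^ _ * _]mulrC.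
by lra.
Qed.

Lemma powR_le_exp (R : realType) (a u v : R) : 0 <= a <= 1 -> 0 < u <= v ->
  a `^ v <= a `^ u.
Proof.
move=> /andP[a0 a1] /andP[u0 uv]; have [->|an0] := eqVneq a 0.
  by rewrite !powR0// gt_eqF// (lt_le_trans u0).
by apply: ger_powR => //; rewrite a1 andbT lt_neqAle eq_sym an0.
Qed.

Lemma cvg_enorm_le (R : realType) (n : nat) (x : nat -> 'rV[R]_n)
    (y l : 'rV[R]_n) (b : R) (N : nat) : x @ \oo --> l ->
  (forall k, (N <= k)%N -> enorm (y - x k) <= b) -> enorm (y - l) <= b.
Proof.
move=> /cvg_enorm xl yb; apply/ler_addgt0Pr => e e0.
have [M _ MP] := xl e e0.
have h1 := yb (maxn N M) (leq_maxl _ _).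
have h2 := MP (maxn N M) (leq_maxr _ _).
by apply: (le_trans (enormB_le _ (x (maxn N M)) _)); rewrite lerD// ltW.
Qed.

Lemma power_recursion (R : realType) (alpha c t w : R) : 0 < alpha < 1 ->
  0 < c -> 0 <= w <= t -> w `^ (1 + alpha) <= c * (t - w) -> forall X,
  w `^ alpha / c <= X ->
  w `^ alpha * (1 + alpha / (c * (1 + X)) * w `^ alpha) <= t `^ alpha.
Proof.
move=> a01 c0 /andP[w0 wt] wc X wX.
have /andP[a0 a1] := a01.
set v := w `^ alpha in wX *.
have v0 : 0 <= v by exact: powR_ge0.
have x0 : 0 <= v / c by rewrite divr_ge0// ltW.
have X0 : 0 < 1 + X by rewrite ltr_pwDl// (le_trans x0).
have ineq : 1 + alpha / (c * (1 + X)) * v <= (1 + v / c) `^ alpha.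
  have y0 : 0 < 1 + v / c by rewrite ltr_pwDl.
  have := @powR_tangent _ (1 + v / c) 1 (1 - alpha).
  rewrite (ltW y0) ler01 subKr powR1 [1 + v / c - 1]addrAC subrr add0r.
  move=> /(_ isT isT).
  have -> : 0 < 1 - alpha < 1 by lra.
  move=> /(_ isT) h.
  have h1 : (1 + v / c) `^ (1 - alpha) <= 1 + v / c.
    apply: ler1_powR; first by rewrite lerDl.
    lra.
  have h2 : 0 <= (1 + v / c) `^ alpha - 1.
    rewrite subr_ge0; have := @ler_powR _ (1 + v / c) _ 0 alpha (ltW a0).
    by rewrite powRr0; apply; rewrite lerDl.
  have h3 : alpha * (v / c) <= (1 + X) * ((1 + v / c) `^ alpha - 1).
    apply: le_trans h _; rewrite ler_wpM2r// (le_trans h1)// lerD2l//.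
  rewrite -lerBrDl.
  have -> : alpha / (c * (1 + X)) * v = alpha * (v / c) / (1 + X).
    by rewrite invfM; ring.
  by rewrite ler_pdivrMr// [leRHS]mulrC.
have wD : w `^ (1 + alpha) = w * v.
  by rewrite powRD ?powRr1// gt_eqF// addr_gt0.
have tw : w * (1 + v / c) <= t.
  rewrite wD in wc; rewrite mulrDr mulr1 mulrA -lerBrDl ler_pdivrMr//.
  by rewrite [leRHS]mulrC.
apply: le_trans (_ : v * (1 + v / c) `^ alpha <= _); first by rewrite ler_wpM2l.
rewrite -powRM//; last by rewrite addr_ge0.
by apply: ge0_ler_powR; rewrite ?nnegrE ?(ltW a0)// ?mulr_ge0 ?addr_ge0// (le_trans w0).
Qed.

(** Since t (1 + mu t) increases in t, a value of v_{n+1} above A/(n+2) would force mu A (n+1) <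
    n+2, against mu A >= 2. In [A], the summand v_0 starts the induction and 2/mu ensures mu A >=
    2. *)
Lemma harmonic_bound (R : realType) (v : nat -> R) (mu : R) : 0 < mu ->
  (forall n, 0 <= v n) ->
  (forall n, v n.+1 * (1 + mu * v n.+1) <= v n) ->
  forall n, v n <= (v 0%N + 2 / mu) / n.+1%:R.
Proof.
move=> mu0 v0 vS; set A := _ + _.
have A0 : 0 < A by rewrite /A ltr_wpDl// divr_gt0.
have muA : 2 <= mu * A.
  by rewrite /A mulrDr mulrCA divff ?gt_eqF// mulr1 lerDr mulr_ge0// ltW.
elim=> [|n IH]; first by rewrite divr1 /A lerDl divr_ge0// ltW.
rewrite leNgt; apply/negP => h.
have n1 : (0 : R) < n.+1%:R by [].
have n2 : (0 : R) < n.+2%:R by [].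
set a := A / n.+2%:R in h.
have a0 : 0 < a by rewrite divr_gt0.
have h1 : a * (1 + mu * a) < A / n.+1%:R.
  apply: lt_le_trans IH; apply: lt_le_trans (vS n).
  have : mu * a < mu * v n.+1 by rewrite ltr_pM2l.
  move=> h2; apply: ltr_pM => //; [exact: ltW|by rewrite addr_ge0// mulr_ge0 ?ltW|].
  by rewrite ltrD2l.
move: h1; rewrite ltr_pdivlMr//.
have Aa : A = a * n.+2%:R by rewrite /a divfK// gt_eqF.
rewrite Aa -mulrA ltr_pM2l// => h1.
have : 2 * n.+1%:R <= mu * a * n.+2%:R * n.+1%:R.
  by rewrite ler_pM2r// -mulrA -Aa.
have nn : n.+2%:R = n.+1%:R + 1 :> R by rewrite -natr1.
have n3 : (1 : R) <= n.+1%:R by rewrite ler1n.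
rewrite nn in h1 *.
have h2 : mu * a * n.+1%:R < 1 by lra.
have : mu * a * n.+1%:R * (n.+1%:R + 1) < n.+1%:R + 1 by rewrite gtr_pMl// ltr_wpDl.
lra.
Qed.

Section KLRates.
Context {R : realType} {n : nat}.
Variables (x : nat -> 'rV[R]_n) (l : 'rV[R]_n) (s e : nat -> R) (m K theta : R).
Hypotheses (x_cvg : x @ \oo --> l) (m_gt0 : 0 < m) (K_gt0 : 0 < K).
Hypotheses (theta01 : 0 < theta < 1).
Hypotheses (s01 : forall k, 0 <= s k <= 1).
Hypotheses (s_decr : forall k, s k.+1 <= s k).
Hypotheses (step_le : forall k, enorm (x k.+1 - x k) <= e k.+1).
(** In the application [e k] is the sum of two successive step lengths and [s k] the excess of the
    auxiliary value over its limit. *)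
Hypotheses (descent : forall k, m * e k.+2 ^+ 2 <= s k - s k.+3).
Hypotheses (kl : forall k, s k `^ theta <= K * e k).

Let s_ge0 k : 0 <= s k. Proof. by have /andP[] := s01 k. Qed.

Let e_ge0 k : 0 <= e k.
Proof. by rewrite -(pmulr_rge0 _ K_gt0) (le_trans (powR_ge0 _ _) (kl k)). Qed.

Let s_mono i j : (i <= j)%N -> s j <= s i.
Proof.
by move=> ij; rewrite -(subnK ij); elim: (j - i)%N => // k; apply: le_trans (s_decr _).
Qed.

Let p k := s k `^ (1 - theta).
Let C := K / (m * (1 - theta)).
(** A potential chosen so that T_k - T_{k+1} = e_k - e_{k+2} + C (p_k - p_{k+3}). *)
Let T k := e k + e k.+1 + C * (p k + p k.+1 + p k.+2).

Let C_gt0 : 0 < C.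
Proof. by have /andP[? ?] := theta01; rewrite /C divr_gt0// mulr_gt0// subr_gt0. Qed.

Let T_ge0 k : 0 <= T k.
Proof. by rewrite /T !addr_ge0// mulr_ge0 ?(ltW C_gt0)// !addr_ge0// powR_ge0. Qed.

(* The desingularized values [p] turn the quadratic decrease into
   [2 e_{k+2} <= e_k + C (p_k - p_{k+3})], and [T] telescopes it. *)
Let step_telescope k : e k.+2 <= T k - T k.+1.
Proof.
have /andP[t0 t1] := theta01.
have pp : p k.+3 <= p k.
  apply: ge0_ler_powR; rewrite ?nnegrE ?subr_ge0 ?(ltW t1)//.
  by apply: s_mono; rewrite -addn3 leq_addr.
set X := C * (p k - p k.+3).
have X0 : 0 <= X by rewrite mulr_ge0 ?(ltW C_gt0)// subr_ge0.
have eX : e k.+2 ^+ 2 <= e k * X.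
  have h1 := descent k.
  have h2 := powR_tangent (s_ge0 k) (s_ge0 k.+3) theta01.
  have h3 : s k `^ theta * (p k - p k.+3) <= K * e k * (p k - p k.+3).
    by rewrite ler_wpM2r ?subr_ge0.
  have u0 : 0 < 1 - theta by lra.
  have h4 : (1 - theta) * (m * e k.+2 ^+ 2) <= (1 - theta) * (s k - s k.+3).
    by rewrite ler_pM2l.
  have -> : e k * X = K * e k * (p k - p k.+3) / (m * (1 - theta)).
    by rewrite /X /C; ring.
  rewrite ler_pdivlMr ?mulr_gt0//.
  apply: le_trans h3; apply: le_trans h2; lra.
(* Arithmetic-geometric mean: 4 e_k X <= (e_k + X)^2. *)
have : (2 * e k.+2) ^+ 2 <= (e k + X) ^+ 2.
  by have := sqr_ge0 (e k - X); rewrite !expr2 in eX *; lra.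
rewrite ler_pXn2r ?nnegrE ?addr_ge0// ?mulr_ge0// => h.
have -> : T k - T k.+1 = e k - e k.+2 + X by rewrite /T /X; ring.
lra.
Qed.

(** The distance travelled from [x k.+1] plus the remaining potential never exceeds [T k]; then the
    endpoint tends to [l]. *)
Let tail_le k : enorm (x k.+1 - l) <= T k.
Proof.
apply: (@cvg_enorm_le _ _ _ _ _ _ k.+1 x_cvg) => j kj.
rewrite -(subnK kj) enormBC.
suff : enorm (x ((j - k.+1) + k.+1)%N - x k.+1) + T (j - k.+1 + k) <= T k.
  by have := T_ge0 (j - k.+1 + k); lra.
elim: (j - k.+1)%N => [|i IH]; first by rewrite subrr enorm0 add0r.
apply: le_trans IH; rewrite !addSn addnS.
have := enormB_le (x (i + k).+2) (x (i + k).+1) (x k.+1).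
have := step_le (i + k).+1; have := step_telescope (i + k).
lra.
Qed.

(** Reduces rates for [x] to rates for [s]. In [T k.+2] the terms in [e] are at most sqrt(s_k / m)
    by the descent, and those in [p] at most s_k^(1 - theta); as s_k <= 1, the smaller exponent
    [gamma] dominates both. *)
Lemma kl_tail (gamma : R) : 0 < gamma <= 2^-1 -> gamma <= 1 - theta ->
  exists2 c, 0 < c & forall k, enorm (x k.+3 - l) <= c * s k `^ gamma.
Proof.
move=> /andP[g0 g2] g1; have /andP[t0 t1] := theta01.
have sm0 : 0 < Num.sqrt m by rewrite sqrtr_gt0.
exists (2 / Num.sqrt m + 3 * C) => [|k].
  by rewrite addr_gt0 ?divr_gt0// mulr_gt0.
apply: le_trans (tail_le _) _.
have pb j : (k <= j)%N -> p j <= s k `^ gamma.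
  move=> kj; apply: le_trans (_ : s k `^ (1 - theta) <= _).
    apply: ge0_ler_powR; rewrite ?nnegrE ?subr_ge0 ?(ltW t1)//.
    exact: s_mono.
  by apply: powR_le_exp => //; rewrite g0.
have eb j : (k <= j)%N -> e j.+2 <= s k `^ gamma / Num.sqrt m.
  move=> kj; rewrite ler_pdivlMr//.
  apply: le_trans (_ : s k `^ (2^-1) <= _); last first.
    by apply: powR_le_exp => //; rewrite g0.
  rewrite powR12_sqrt// -(@ler_pXn2r _ 2)// ?nnegrE ?sqrtr_ge0 ?mulr_ge0 ?(ltW sm0)//.
  rewrite exprMn !sqr_sqrtr ?(ltW m_gt0)// mulrC.
  have := descent j; have := s_ge0 j.+3; have := s_mono kj; lra.
have := pb k.+2 (ltnW (leqnSn _)); have := pb k.+3 (leq_trans (leqnSn _) (ltnW (leqnSn _))).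
have := pb k.+4 (leq_trans (leqnSn _) (leq_trans (leqnSn _) (ltnW (leqnSn _)))).
have := eb k (leqnn _); have := eb k.+1 (leqnSn _) => h1 h2 h3 h4 h5.
have h6 : C * (p k.+2 + p k.+3 + p k.+4) <= C * (3 * s k `^ gamma).
  by rewrite ler_pM2l//; lra.
rewrite /T; move: h1 h2 h6; move: (Num.sqrt m)^-1 => r; lra.
Qed.

(** The KL bound at [k.+2], squared, combined with the descent. The linear case takes u = 1, the
    sublinear one u = 2 theta. *)
Let two_theta k (u : R) : 0 < u -> 2 * theta <= u ->
  s k.+3 `^ u <= K ^+ 2 / m * (s k - s k.+3).
Proof.
move=> u0 tu; have /andP[t0 t1] := theta01.
apply: le_trans (_ : s k.+2 `^ (theta * 2) <= _).
  apply: le_trans (_ : s k.+2 `^ u <= _).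
    by apply: ge0_ler_powR; rewrite ?nnegrE ?(ltW u0).
  by apply: powR_le_exp => //; rewrite mulrC mulr_gt0.
rewrite powRrM powR_mulrn ?powR_ge0//.
apply: le_trans (_ : (K * e k.+2) ^+ 2 <= _).
  by rewrite ler_pXn2r ?nnegrE ?powR_ge0 ?mulr_ge0 ?(ltW K_gt0).
rewrite exprMn -mulrA ler_wpM2l ?sqr_ge0// mulrC ler_pdivlMr// mulrC.
exact: descent.
Qed.

Let c_gt0 : 0 < K ^+ 2 / m. Proof. by rewrite divr_gt0// exprn_gt0. Qed.

Lemma kl_linear_rate : theta <= 2^-1 ->
  exists c eta, [/\ 0 < c, 0 < eta < 1
    & forall k, enorm (x k.+3 - l) <= c * eta ^+ k].
Proof.
move=> t2; have /andP[t0 t1] := theta01.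
pose c := K ^+ 2 / m; have c0 : 0 < c := c_gt0.
have [c1 c10 c1P] := @kl_tail 2^-1 ltac:(lra) ltac:(lra).
pose q := c / (1 + c).
have c'0 : 0 < 1 + c by rewrite addr_gt0.
have q0 : 0 < q by rewrite divr_gt0.
have q1 : q < 1 by rewrite ltr_pdivrMr//; lra.
have sq k : s k.+3 <= q * s k.
  have := @two_theta k 1 ltr01; rewrite powRr1// -/c => /(_ ltac:(lra)) h.
  by rewrite /q mulrAC ler_pdivlMr//; lra.
(* A sixth root: [q] contracts over three indices, and the distance is controlled by the square root
   of [s]. *)
pose eta := q `^ (6^-1).
have eta0 : 0 < eta by rewrite powR_gt0.
have eta6 : eta ^+ 6 = q.
  by rewrite -powR_mulrn ?(ltW eta0)// -powRrM mulVf ?pnatr_eq0// powRr1// ltW.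
have eta1 : eta < 1.
  by rewrite -(@expr_lt1 _ 6) ?(ltW eta0)// eta6.
(* Dividing by eta^4 lets s <= 1 settle the three base cases k <= 2. *)
have s_geo k : s k <= (eta ^+ 2) ^+ k / eta ^+ 4.
  have e4 : 0 < eta ^+ 4 by rewrite exprn_gt0.
  have base i : (i <= 2)%N -> s i <= (eta ^+ 2) ^+ i / eta ^+ 4.
    move=> i2; rewrite ler_pdivlMr// -exprM.
    apply: le_trans (_ : eta ^+ 4 <= _).
      by rewrite ler_piMl ?(ltW e4)//; have /andP[] := s01 i.
    by apply: ler_wiXn2l; rewrite ?(ltW eta0) ?(ltW eta1)// (leq_mul2l 2 i 2) i2 orbT.
  suff H : forall j, [/\ s j <= (eta ^+ 2) ^+ j / eta ^+ 4,
      s j.+1 <= (eta ^+ 2) ^+ j.+1 / eta ^+ 4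
    & s j.+2 <= (eta ^+ 2) ^+ j.+2 / eta ^+ 4] by have [] := H k.
  elim=> [|j [h0 h1 h2]]; first by split; exact: base.
  split=> //; apply: le_trans (sq j) _.
  have -> : (eta ^+ 2) ^+ j.+3 / eta ^+ 4 = q * ((eta ^+ 2) ^+ j / eta ^+ 4).
    by rewrite -eta6 !exprS; ring.
  by rewrite ler_pM2l.
exists (c1 / eta ^+ 2), eta; split.
- by rewrite divr_gt0// exprn_gt0.
- by rewrite eta0.
move=> k; apply: le_trans (c1P k) _.
rewrite -mulrA ler_pM2l// powR12_sqrt//.
have h : 0 <= (eta ^+ 2)^-1 * eta ^+ k.
  by rewrite mulr_ge0 ?invr_ge0 ?exprn_ge0 ?ltW.
rewrite -(ger0_norm h) -sqrtr_sqr ler_wsqrtr// (le_trans (s_geo k))//.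
by rewrite [leRHS]exprMn exprVn mulrC -!exprM (mulnC k).
Qed.

Lemma kl_sublinear_rate : 2^-1 < theta ->
  exists2 c, 0 < c & forall k, enorm (x k.+3 - l) <=
    c * k.+1%:R `^ (- ((1 - theta) / (2 * theta - 1))).
Proof.
move=> t2; have /andP[t0 t1] := theta01.
pose c := K ^+ 2 / m; have c0 : 0 < c := c_gt0.
have [c1 c10 c1P] := @kl_tail (1 - theta) ltac:(lra) ltac:(lra).
pose alpha := 2 * theta - 1.
have a0 : 0 < alpha by rewrite /alpha; lra.
(* Every third index is sampled, since [two_theta] compares [s k] with [s k.+3]. *)
pose v k := s (3 * k)%N `^ alpha.
pose X := v 0%N / c.
have X0 : 0 <= X by rewrite divr_ge0 ?powR_ge0// ltW.
have v0 k : 0 <= v k by exact: powR_ge0.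
have vS k : v k.+1 * (1 + alpha / (c * (1 + X)) * v k.+1) <= v k.
  rewrite /v mulnS addnC addn3; apply: power_recursion => //.
  - by rewrite a0 /alpha; lra.
  - by rewrite s_ge0 s_mono// -[leqRHS]addn3 leq_addr.
  - have -> : 1 + alpha = 2 * theta by rewrite /alpha; ring.
    by apply: two_theta; lra.
  rewrite ler_pM2r ?invr_gt0//.
  by apply: ge0_ler_powR; rewrite ?nnegrE ?(ltW a0)// s_mono.
have mu0 : 0 < alpha / (c * (1 + X)).
  by rewrite divr_gt0// mulr_gt0// ltr_wpDr.
have vb := harmonic_bound mu0 v0 vS.
set A := v 0%N + _ in vb.
have A0 : 0 < A by rewrite /A ltr_wpDl// divr_gt0.
pose tau := (1 - theta) / alpha.
have tau0 : 0 < tau by rewrite divr_gt0// subr_gt0.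
exists (c1 * (3 * A) `^ tau); first by rewrite mulr_gt0// powR_gt0// mulr_gt0.
move=> k; apply: le_trans (c1P k) _; rewrite -mulrA ler_pM2l//.
rewrite -/alpha -/tau powRN -powR_inv1 ?powR_ge0//.
have k1 : (0 : R) < k.+1%:R by [].
rewrite powR_inv1 ?powR_ge0//.
rewrite -powRN.
have -> : k.+1%:R `^ (- tau) = k.+1%:R^-1 `^ tau.
  by rewrite -powR_inv1 ?(ltW k1)// -powRrM mulN1r.
rewrite -powRM ?invr_ge0 ?mulr_ge0 ?(ltW A0)//.
have -> : 1 - theta = alpha * tau by rewrite /tau mulrC divfK// gt_eqF.
rewrite powRrM; apply: ge0_ler_powR; rewrite ?nnegrE ?powR_ge0 ?(ltW tau0)//.
  by rewrite mulr_ge0 ?invr_ge0 ?mulr_ge0 ?(ltW A0).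
(* Going back to all indices costs the factor 3, by k + 1 <= 3 (k %/ 3 + 1). *)
apply: le_trans (_ : v (k %/ 3)%N <= _).
  apply: ge0_ler_powR; rewrite ?nnegrE ?(ltW a0)// s_mono//.
  by rewrite mulnC leq_trunc_div.
apply: le_trans (vb _) _.
rewrite ler_pdivrMr// mulrAC ler_pdivlMr// [3 * A]mulrC -mulrA ler_pM2l//.
rewrite -natrM ler_nat.
by rewrite mulnC ltn_ceil.
Qed.

End KLRates.

(** * Bregman distance and the subproblem *)

Section RealBregman.
Context {R : realType} {d : nat}.
Variables (H : 'rV[R]_d -> R) (sigma : R).
Hypotheses (H_diff : forall x, differentiable H x) (sigma_gt0 : 0 < sigma).
Hypothesis H_strong : strongly_convex sigma (EFin \o H).

Let gh := grad (EFin \o H).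

Definition breg (u v : 'rV[R]_d) : R :=
  H u - H v - dotv (grad (EFin \o H) v) (u - v).

Lemma bregman_EFin u v : bregman (EFin \o H) u v = (breg u v)%:E.
Proof. by []. Qed.

Lemma breg_ge u v : sigma / 2 * enorm (u - v) ^+ 2 <= breg u v.
Proof.
suff : dotv (gh v) (u - v) <= H u - H v - sigma / 2 * enorm (u - v) ^+ 2.
  by rewrite /breg -/gh; lra.
apply: (@grad_le _ _ _ _ _ _ (sigma / 2 * enorm (u - v) ^+ 2)) => // t /andP[t0 t1].
have := @H_strong u v t I I; rewrite (ltW t0) t1 => /(_ isT).
have -> : t *: u + (1 - t) *: v = v + t *: (u - v).
  by rewrite scalerBr scalerBl scale1r [RHS]addrCA.
rewrite -!EFinB -!EFinM -EFinD lee_fin !enorm_sqr !(dotvDl, dotvNl) !(dotvDr, dotvNr).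
rewrite !(dotvZl, dotvZr, dotvDl, dotvDr, dotvNl, dotvNr) (dotvC v u).
lra.
Qed.

Lemma breg_ge0 u v : 0 <= breg u v.
Proof.
by apply: le_trans (breg_ge u v); rewrite mulr_ge0 ?sqr_ge0// divr_ge0// ltW.
Qed.

Lemma breg_sym u v : breg u v + breg v u = dotv (gh u - gh v) (u - v).
Proof. by rewrite /breg -/gh !dotvBl !dotvBr; lra. Qed.

Lemma breg_le u v : breg u v <= dotv (gh u - gh v) (u - v).
Proof. by rewrite -breg_sym lerDl breg_ge0. Qed.

Lemma breg_three_points u v w :
  dotv (gh v - gh w) (u - v) = breg u w - breg u v - breg v w.
Proof. by rewrite /breg -/gh !dotvBl !dotvBr; lra. Qed.

Lemma bregxx u : breg u u = 0.
Proof. by rewrite /breg !subrr dotv0 subr0. Qed.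

(** The gradient inequality of the convex function L H - F: a descent lemma with a Bregman distance
    in place of the squared norm. *)
Lemma smad_upper (F : 'rV[R]_d -> R) (L : R) (u v : 'rV[R]_d) :
  differentiable F v ->
  econvex_on setT (fun x => (L%:E * (H x)%:E - (F x)%:E)%E) ->
  F u <= F v + dotv (grad (EFin \o F) v) (u - v) + L * breg u v.
Proof.
move=> dF cv.
have dLH : differentiable (L *: H) v by exact: differentiableZ.
have dP : differentiable (L *: H - F) v by exact: differentiableB.
have cP (t : R) : 0 < t <= 1 -> (L *: H - F) (v + t *: (u - v)) <=
    (L *: H - F) v + t * ((L *: H - F) u - (L *: H - F) v) + t ^+ 2 * 0.
  move=> /andP[t0 t1].
  have -> : v + t *: (u - v) = t *: u + (1 - t) *: v.
    by rewrite scalerBr scalerBl scale1r addrCA.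
  have t01 : 0 <= t <= 1 by rewrite (ltW t0).
  have h : L * H (t *: u + (1 - t) *: v) - F (t *: u + (1 - t) *: v) <=
    t * (L * H u - F u) + (1 - t) * (L * H v - F v) by have := @cv u v t I I t01.
  change (L * H (t *: u + (1 - t) *: v) - F (t *: u + (1 - t) *: v) <=
   L * H v - F v + t * (L * H u - F u - (L * H v - F v)) + t ^+ 2 * 0).
  lra.
have := diff_le dP cP.
rewrite diffB// diffZ// => h.
have {h} : L * 'd H v (u - v) - 'd F v (u - v) <= L * H u - F u - (L * H v - F v).
  exact: h.
by rewrite !diff_grad// /breg -/gh; lra.
Qed.

(** Optimality condition without a sum rule: convexity of [G] along the segment from [u] to [w]
    turns minimality into an upper bound on - H there, which is differentiated at [u]. *)
Lemma prox_subgradient (G : 'rV[R]_d -> R) (lam : R) (c y u : 'rV[R]_d) :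
  0 < lam -> econvex (EFin \o G) ->
  (forall v, G u + dotv c (u - y) + lam^-1 * breg u y <=
             G v + dotv c (v - y) + lam^-1 * breg v y) ->
  forall w, dotv (- c - lam^-1 *: (gh u - gh y)) (w - u) <= G w - G u.
Proof.
move=> lam0 cG umin w.
have dN : differentiable (- H) u by exact: differentiableN.
have il0 : 0 < lam^-1 by rewrite invr_gt0.
have cP (t : R) : 0 < t <= 1 -> (- H) (u + t *: (w - u)) <=
    (- H) u + t * (lam * (G w - G u + dotv c (w - u)) - dotv (gh y) (w - u)) + t ^+ 2 * 0.
  move=> /andP[t0 t1].
  have vE : u + t *: (w - u) = t *: w + (1 - t) *: u.
    by rewrite scalerBr scalerBl scale1r addrCA.
  have := @cG w u t I I; rewrite (ltW t0) t1 => /(_ isT).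
  rewrite -!EFinM -EFinD lee_fin -vE => {vE}.
  set e := w - u => h1; have := umin (u + t *: e).
  have -> : u + t *: e - y = u - y + t *: e by rewrite addrAC.
  rewrite /breg -/gh.
  have -> : u + t *: e - y = u - y + t *: e by rewrite addrAC.
  rewrite !(dotvDr _ (t *: e)) !dotvZr.
  change ((- H) (u + t *: e)) with (- H (u + t *: e)).
  change ((- H) u) with (- H u).
  move: h1; move: (u + t *: e) => v h1 h2.
  have h3 : lam^-1 * (- H v + H u + t * dotv (gh y) e) <=
    t * (G w - G u) + t * dotv c e.
    lra.
  rewrite -(ler_pM2l lam0) mulVKf ?gt_eqF// in h3.
  lra.
have := diff_le dN cP; rewrite diffN// => h.
have {h} : - 'd H u (w - u) <=
  lam * (G w - G u + dotv c (w - u)) - dotv (gh y) (w - u) by exact: h.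
rewrite diff_grad// -/gh => h.
rewrite dotvBl dotvNl dotvZl dotvBl.
rewrite -(ler_pM2l lam0) mulrBr mulVKf ?gt_eqF//.
lra.
Qed.

End RealBregman.

(** * Slope bound for the auxiliary function and one-step descent *)

Lemma enorm_submx_le (R : realType) (d : nat) (z : 'rV[R]_(d + d)) :
  enorm (lsubmx z) <= enorm z /\ enorm (rsubmx z) <= enorm z.
Proof.
by split; rewrite -(@ler_pXn2r _ 2)// ?nnegrE ?enorm_ge0// (enorm_submx_sqr z)
  ?lerDl ?lerDr sqr_ge0.
Qed.

Lemma enorm_row_mx_le (R : realType) (d : nat) (u v : 'rV[R]_d) :
  enorm (row_mx u v) <= enorm u + enorm v.
Proof.
rewrite -(@ler_pXn2r _ 2)// ?nnegrE ?addr_ge0 ?enorm_ge0//.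
rewrite enorm_submx_sqr row_mxKl row_mxKr.
by have := mulr_ge0 (enorm_ge0 u) (enorm_ge0 v); lra.
Qed.

Lemma dotv_le_of (R : realType) (n : nat) (u v : 'rV[R]_n) (a b : R) :
  enorm u <= a -> enorm v <= b -> dotv u v <= a * b.
Proof.
by move=> ua vb; apply: le_trans (dotv_le u v) _; apply: ler_pM; rewrite ?enorm_ge0.
Qed.

Lemma breg_shift (R : realType) (d : nat) (H : 'rV[R]_d -> R) a b w w' :
  breg H w' w - breg H b a = breg H w' b + breg H a w
    - dotv (grad (EFin \o H) w - grad (EFin \o H) b) (w' - b)
    - dotv (grad (EFin \o H) w - grad (EFin \o H) a) (b - a).
Proof. by rewrite /breg !dotvBl !dotvBr; lra. Qed.

Section Auxiliary.
Context {R : realType} {d : nat}.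
Variables (F1 F2 G H : 'rV[R]_d -> R) (sigma M : R).
Hypotheses (H_diff : forall x, differentiable H x) (sigma_gt0 : 0 < sigma).
Hypotheses (H_strong : strongly_convex sigma (EFin \o H)) (M_gt0 : 0 < M).

Let g1 := grad (EFin \o F1).
Let g2 := grad (EFin \o F2).
Let gh := grad (EFin \o H).

Definition aux_real (z : 'rV[R]_(d + d)) : R :=
  F1 (lsubmx z) - F2 (lsubmx z) + G (lsubmx z) + M * breg H (rsubmx z) (lsubmx z).

Lemma aux_real_row_mx a b :
  aux_real (row_mx a b) = F1 a - F2 a + G a + M * breg H b a.
Proof. by rewrite /aux_real row_mxKl row_mxKr. Qed.

(** [F1] and [G] lie above their linearisations; [F2] contributes its gradient at [w], exchanged for
    the one at [a] at a quadratic cost; [breg_shift] handles the Bregman term. There |b - a| enters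
    twice, through grad H at [b] against [a] and through the inner product with b - a, hence 2 M
    K. *)
Lemma auxiliary_subgradient (a b zeta : 'rV[R]_d) (K r e : R) :
  lower_semicontinuous (EFin \o aux_real) -> 0 < K -> 0 < r -> 0 < e ->
  (forall w, dotv (g1 a) (w - a) <= F1 w - F1 a) ->
  (forall w, dotv zeta (w - a) <= G w - G a) ->
  (forall w, enorm (w - a) <= r ->
    [/\ F2 w - F2 a <= dotv (g2 w) (w - a),
        enorm (g2 w - g2 a) <= K * enorm (w - a)
      & enorm (gh w - gh a) <= K * enorm (w - a)]) ->
  enorm (gh b - gh a) <= K * enorm (b - a) ->
  exists2 v, limiting_subdiff (EFin \o aux_real) (row_mx a b) v &
    enorm v <= 2 * (enorm (g1 a - g2 a + zeta) + 2 * M * K * enorm (b - a) + e).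
Proof.
move=> lscA K0 r0 e0 h1 hG hr hb.
set nu := _ + zeta; set be := enorm (b - a).
have be0 : 0 <= be by exact: enorm_ge0.
have MK0 : 0 < (1 + M) * K by rewrite mulr_gt0// addr_gt0.
(* (1 + M) K is the total coefficient of the quadratic errors; on this radius they are absorbed by
   the slope [e]. *)
pose r' := Num.min r (e / ((1 + M) * K)).
have r'0 : 0 < r' by rewrite lt_min r0 divr_gt0.
apply: (@slope_limiting _ _ aux_real _ _ r') => //.
  by rewrite !addr_ge0 ?mulr_ge0 ?enorm_ge0 ?(ltW M_gt0) ?(ltW K0) ?(ltW e0).
move=> z' zr; rewrite aux_real_row_mx /aux_real.
have [] := enorm_submx_le (z' - row_mx a b).
set N := enorm (z' - _) in zr *.
rewrite !linearB/= row_mxKl row_mxKr.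
move: (lsubmx z') (rsubmx z') => w w'.
set p := enorm (w - a); set q := enorm (w' - b) => pN qN.
have N0 : 0 <= N by exact: enorm_ge0.
have p0 : 0 <= p by exact: enorm_ge0.
have q0 : 0 <= q by exact: enorm_ge0.
have Nr : N <= r by apply: le_trans zr _; rewrite ge_min lexx.
have Ne : N * ((1 + M) * K) <= e.
  by rewrite -ler_pdivlMr//; apply: le_trans zr _; rewrite ge_min lexx orbT.
have [k1 k2 k3] := hr w (le_trans pN Nr).
have k4 := h1 w; have k5 := hG w.
have k6 : dotv (g2 w - g2 a) (w - a) <= K * p * p := dotv_le_of k2 (lexx p).
have k7 : - (enorm nu * p) <= dotv nu (w - a) by exact: dotv_ge.
have k8 : dotv (gh w - gh b) (w' - b) <= (K * p + K * be) * q.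
  apply: (dotv_le_of _ (lexx q)); apply: le_trans (enormB_le _ (gh a) _) _.
  by apply: lerD k3 _; rewrite (enormBC (gh a)).
have k9 : dotv (gh w - gh a) (b - a) <= K * p * be := dotv_le_of k3 (lexx be).
have k10 := breg_ge0 H_diff sigma_gt0 H_strong w' b.
have k11 := breg_ge0 H_diff sigma_gt0 H_strong a w.
have k12 : breg H w' w - breg H b a >= - ((K * p + K * be) * q) - K * p * be.
  by rewrite breg_shift; move: k8 k9 k10 k11; clear -g1 g2 gh G M_gt0 H_strong H_diff sigma_gt0; lra.
have k13 : F1 w - F2 w + G w - (F1 a - F2 a + G a) >= - (enorm nu * p) - K * p * p.
  have k14 : dotv nu (w - a) =
      dotv (g1 a) (w - a) - dotv (g2 a) (w - a) + dotv zeta (w - a).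
    by rewrite /nu dotvDl dotvBl.
  by move: k1 k4 k5 k6 k7; rewrite k14 dotvBl; clear -g1 g2 gh G M_gt0 H_strong H_diff sigma_gt0; lra.
have b1 : enorm nu * p <= enorm nu * N by rewrite ler_wpM2l// enorm_ge0.
have b2 : K * p * p <= K * N * N by rewrite -!mulrA ler_pM2l// ler_pM.
have b3 : (K * p + K * be) * q <= (K * N + K * be) * N.
  by rewrite ler_pM ?addr_ge0 ?mulr_ge0 ?(ltW K0)// lerD2r ler_pM2l.
have b4 : K * p * be <= K * N * be by rewrite ler_wpM2r// ler_pM2l.
have b5 : M * (- ((K * N + K * be) * N) - K * N * be) <= M * (breg H w' w - breg H b a).
  by rewrite ler_pM2l//; move: k12 b3 b4; clear -g1 g2 gh G M_gt0 H_strong H_diff sigma_gt0; lra.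
have b6 : N * (N * ((1 + M) * K)) <= N * e by rewrite ler_wpM2l.
move: k13 b1 b2 b5 b6; clear -g1 g2 gh G M_gt0 H_strong H_diff sigma_gt0; lra.
Qed.

End Auxiliary.

(** The subgradient inequality of [G] is tested at the old iterate [x], and the linear terms cancel
    against those of [F1] and [F2]. The three-point identity leaves D(x,y) - D(x,x1) - D(x1,y) over
    [lam]: lam L < 1 absorbs D(x1,y), and the restart test bounds D(x,y). *)
Lemma descent_step (R : realType) (d : nat) (F1 F2 G H : 'rV[R]_d -> R)
    (L lam rho M : R) (x0 x y x1 xi : 'rV[R]_d) :
  0 < lam -> lam * L < 1 -> 0 <= breg H x1 y ->
  (forall w, dotv (xi - grad (EFin \o F1) y -
                   lam^-1 *: (grad (EFin \o H) x1 - grad (EFin \o H) y)) (w - x1)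
             <= G w - G x1) ->
  dotv xi (x1 - x) <= F2 x1 - F2 x ->
  F1 x1 <= F1 y + dotv (grad (EFin \o F1) y) (x1 - y) + L * breg H x1 y ->
  dotv (grad (EFin \o F1) y) (x - y) <= F1 x - F1 y ->
  breg H x y <= rho * breg H x0 x ->
  (F1 x1 - F2 x1 + G x1 + M * breg H x x1) +
    ((M - rho / lam) * breg H x0 x + (lam^-1 - M) * breg H x x1)
  <= F1 x - F2 x + G x + M * breg H x0 x.
Proof.
move=> lam0 lamL D0 hG h2 h1 h1' hrho.
have il0 : 0 < lam^-1 by rewrite invr_gt0.
have k1 := hG x.
have k2 := breg_three_points H x x1 y.
have k3 : lam^-1 * breg H x y <= lam^-1 * (rho * breg H x0 x) by rewrite ler_pM2l.
have k4 : 0 <= (lam^-1 - L) * breg H x1 y.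
  rewrite mulr_ge0// subr_ge0 -(ler_pM2l lam0) mulfV ?gt_eqF//; exact: ltW.
have k5 : lam^-1 * dotv (grad (EFin \o H) x1 - grad (EFin \o H) y) (x - x1) =
   lam^-1 * (breg H x y - breg H x x1 - breg H x1 y) by rewrite k2.
rewrite dotvBl (dotvBl xi) dotvZl k5 in k1.
move: h1 h1' h2 k1; set g := grad (EFin \o F1) y; rewrite !dotvBr => h1 h1' h2 k1.
lra.
Qed.

(** * Convergence of the iterates *)

(** The subgradient inequality is tested in the direction xi - grad F x itself. *)
Lemma subgradient_grad (R : realType) (n : nat) (F : 'rV[R]_n -> R)
    (x xi : 'rV[R]_n) : differentiable F x ->
  (forall w, dotv xi (w - x) <= F w - F x) -> xi = grad (EFin \o F) x.
Proof.
move=> dF sub; have dN : differentiable (- F) x by exact: differentiableN.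
have le v : dotv (xi - grad (EFin \o F) x) v <= 0.
  have cP (t : R) : 0 < t <= 1 ->
      (- F) (x + t *: v) <= (- F) x + t * (- dotv xi v) + t ^+ 2 * 0.
    move=> _; have := sub (x + t *: v); rewrite addrAC subrr add0r dotvZr.
    change ((- F) (x + t *: v)) with (- F (x + t *: v)).
    change ((- F) x) with (- F x).
    lra.
  have := diff_le dN cP; rewrite diffN// => h.
  have {h} : - 'd F x v <= - dotv xi v by exact: h.
  by rewrite diff_grad// dotvBl; lra.
apply/subr0_eq/dotv_eq0/eqP.
by rewrite eq_le le dotv_ge0.
Qed.

Lemma dotv_cvg (R : realType) (n : nat) (u v : nat -> 'rV[R]_n) (a b : 'rV[R]_n) :
  u @ \oo --> a -> v @ \oo --> b ->
  (fun k => dotv (u k) (v k)) @ \oo --> dotv a b.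
Proof.
move=> ua vb.
have nu := cvg_enorm_norm ua; have nv := cvg_enorm_norm vb.
pose w k := enorm (u k - a) * (enorm (v k - b) + enorm b) + enorm a * enorm (v k - b).
have w0 : w @ \oo --> (0 : R).
  have -> : 0 = 0 * (0 + enorm b) + enorm a * 0 by rewrite mul0r mulr0 addr0.
  apply: cvgD; first by apply: cvgM => //; apply: cvgD => //; exact: cvg_cst.
  by apply: cvgM => //; exact: cvg_cst.
apply/cvgrPdist_le => e e0.
move/cvgrPdist_le : w0 => /(_ e e0); apply: filterS => k; rewrite sub0r normrN.
apply: le_trans; apply: le_trans (ler_norm _).
have v_le : enorm (v k) <= enorm (v k - b) + enorm b.
  by rewrite -{1}(subrK b (v k)) enormD.
have h1 := dotv_le_of (lexx (enorm (u k - a))) v_le.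
have h2 := dotv_le a (v k - b).
have h3 : dotv (- (u k - a)) (v k) <= enorm (u k - a) * (enorm (v k - b) + enorm b).
  by apply: dotv_le_of => //; rewrite enormN.
have h4 := dotv_ge a (v k - b).
rewrite dotvNl !dotvBl !dotvBr in h1 h2 h3 h4.
by rewrite /w ler_norml; lra.
Qed.

Lemma enormB_le_half (R : realType) (n : nat) (u v w : 'rV[R]_n) (r : R) :
  enorm (u - v) <= r / 2 -> enorm (v - w) <= r / 2 -> enorm (u - w) <= r.
Proof. by move=> h1 h2; have := enormB_le u v w; lra. Qed.

Lemma subgradient_regroup (V : zmodType) (a b c u v : V) :
  a - b + (c - u - v) = (a - u) + ((c - b) - v).
Proof. by rewrite !addrA (addrAC a (- b) c) (addrAC a (- u) c) (addrAC (a + c)). Qed.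

Lemma enorm_combination (R : realType) (n : nat) (u v w : 'rV[R]_n) (a : R) :
  0 <= a -> enorm (u + (v - a *: w)) <= enorm u + enorm v + a * enorm w.
Proof.
move=> a0; rewrite -addrA; apply: le_trans (enormD _ _) _; rewrite lerD2l.
by apply: le_trans (enormD _ _) _; rewrite enormN enormZ ger0_norm.
Qed.

Lemma combination_bound (R : realType) (K il M a d0 d1 : R) :
  0 <= K -> 0 <= il -> 0 <= M -> 0 <= d0 -> 0 <= d1 -> a <= d0 + d1 ->
  K * a + K * d1 + il * (K * a) + 2 * M * K * d1 <=
  (2 * K + K * il + 2 * M * K) * (d0 + d1).
Proof.
move=> K0 il0 M0 p0 p1 ad.
have h1 : K * a <= K * (d0 + d1) by rewrite ler_wpM2l.
have h2 : il * (K * a) <= il * (K * (d0 + d1)) by rewrite ler_wpM2l.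
have h3 : 0 <= K * d0 by rewrite mulr_ge0.
have h4 : 0 <= M * (K * d0) by rewrite !mulr_ge0.
lra.
Qed.

(** The offset 4 is 3 from the abstract rates plus 1 from applying them to [x (N + k).+1]. *)
Lemma shift_index (N k : nat) :
  (N + 4 <= k)%N -> (N + (k - (N + 4)).+3).+1 = k.
Proof. lia. Qed.

Lemma shift_index_le (N k : nat) :
  (N + 4 <= k -> k <= (N + 4) * (k - (N + 4)).+1)%N.
Proof. nia. Qed.

Section Iterates.
Context {R : realType} {d : nat}.
Variables (F1 F2 G H : 'rV[R]_d -> R) (L sigma lam rho M K r0 : R).
Variables (x y xi : nat -> 'rV[R]_d) (xt : 'rV[R]_d).

Let g1 := grad (EFin \o F1).
Let g2 := grad (EFin \o F2).
Let gh := grad (EFin \o H).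
Let A := aux_real F1 F2 G H M.
Let zeta k := xi k - g1 (y k) - lam^-1 *: (gh (x k.+1) - gh (y k)).

Hypotheses (sigma_gt0 : 0 < sigma) (lam_gt0 : 0 < lam) (lamL_lt1 : lam * L < 1).
Hypotheses (rho_lt1 : rho < 1) (M_gt0 : 0 < M) (M_lower : rho / lam <= M).
Hypotheses (M_upper : M <= lam^-1) (K_gt0 : 0 < K) (r0_gt0 : 0 < r0).
Hypotheses (H_diff : forall x, differentiable H x).
Hypotheses (H_strong : strongly_convex sigma (EFin \o H)).
Hypotheses (F1_diff : forall x, differentiable F1 x).
Hypotheses (F1_convex : forall u v, dotv (g1 v) (u - v) <= F1 u - F1 v).
Hypotheses (F1_smad : forall u v,
  F1 u <= F1 v + dotv (g1 v) (u - v) + L * breg H u v).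
Hypotheses (G_lsc : lower_semicontinuous (EFin \o G)).
Hypotheses (A_lsc : lower_semicontinuous (EFin \o A)).
Hypotheses (grad_lip : forall u v, enorm (u - xt) <= r0 -> enorm (v - xt) <= r0 ->
  [/\ enorm (gh u - gh v) <= K * enorm (u - v),
      enorm (g1 u - g1 v) <= K * enorm (u - v)
    & enorm (g2 u - g2 v) <= K * enorm (u - v)]).
Hypotheses (F2_diff : forall u, enorm (u - xt) <= r0 -> differentiable F2 u).
Hypotheses (F2_convex : forall u v, enorm (v - xt) <= r0 ->
  dotv (g2 v) (u - v) <= F2 u - F2 v).
Hypotheses (xi_sub : forall k w, dotv (xi k) (w - x k) <= F2 w - F2 (x k)).
Hypotheses (zeta_sub : forall k w, dotv (zeta k) (w - x k.+1) <= G w - G (x k.+1)).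
Hypotheses (restart_breg : forall k,
  breg H (x k.+1) (y k.+1) <= rho * breg H (x k) (x k.+1)).
Hypotheses (restart_step : forall k,
  enorm (y k.+1 - x k.+1) <= enorm (x k.+1 - x k)).
Hypotheses (x_cvg : x @ \oo --> xt).

Let V k := A (row_mx (x k.+1) (x k)).
Let Vt := A (row_mx xt xt).
Let delta k := enorm (x k.+1 - x k).
Let D k := breg H (x k) (x k.+1).

Let D_ge k : sigma / 2 * delta k ^+ 2 <= D k.
Proof. by rewrite /delta enormBC; exact: breg_ge. Qed.

Let descent k : V k.+1 + ((M - rho / lam) * D k + (lam^-1 - M) * D k.+1) <= V k.
Proof.
rewrite /V /A !aux_real_row_mx.
apply: (@descent_step _ _ F1 F2 G H L lam rho M (x k) (x k.+1) (y k.+1) (x k.+2)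
  (xi k.+1)) => //.
- exact: (breg_ge0 H_diff sigma_gt0 H_strong).
- exact: (zeta_sub k.+1).
Qed.

Let V_decr k : V k.+1 <= V k.
Proof.
have D0 j : 0 <= D j by exact: (breg_ge0 H_diff sigma_gt0 H_strong).
apply: le_trans (descent k); rewrite lerDl addr_ge0// mulr_ge0// subr_ge0//.
Qed.

Let V_mono i j : (i <= j)%N -> V j <= V i.
Proof.
by move=> ij; rewrite -(subnK ij); elim: (j - i)%N => // k; apply: le_trans (V_decr _).
Qed.

Let decrease k :
  (1 - rho) / lam * (sigma / 4) * (delta k.+1 + delta k.+2) ^+ 2 <= V k - V k.+3.
Proof.
have h0 := descent k; have h1 := descent k.+1; have h2 := descent k.+2.
have a0 : 0 <= M - rho / lam by rewrite subr_ge0.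
have b0 : 0 <= lam^-1 - M by rewrite subr_ge0.
have D0 j : 0 <= D j by exact: (breg_ge0 H_diff sigma_gt0 H_strong).
have e1 := mulr_ge0 a0 (D0 k); have e2 := mulr_ge0 b0 (D0 k.+3).
have ab : (1 - rho) / lam = (M - rho / lam) + (lam^-1 - M) by rewrite mulrBl mul1r; ring.
have ab0 : 0 <= (1 - rho) / lam by rewrite ab addr_ge0.
(* sigma/2 becomes sigma/4 through (a + b)^2 <= 2 a^2 + 2 b^2. *)
have sq : sigma / 4 * (delta k.+1 + delta k.+2) ^+ 2 <= D k.+1 + D k.+2.
  have h : sigma / 4 * (delta k.+1 + delta k.+2) ^+ 2 <=
      sigma / 2 * delta k.+1 ^+ 2 + sigma / 2 * delta k.+2 ^+ 2.
    rewrite -subr_ge0.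
    have -> : sigma / 2 * delta k.+1 ^+ 2 + sigma / 2 * delta k.+2 ^+ 2 -
      sigma / 4 * (delta k.+1 + delta k.+2) ^+ 2 =
      sigma / 4 * (delta k.+1 - delta k.+2) ^+ 2 by field.
    by rewrite mulr_ge0 ?sqr_ge0// divr_ge0// ltW.
  by have := D_ge k.+1; have := D_ge k.+2; lra.
rewrite -mulrA; apply: le_trans (_ : (1 - rho) / lam * (D k.+1 + D k.+2) <= _).
  by rewrite ler_wpM2l.
rewrite ab; lra.
Qed.

Let close (c : R) : 0 < c -> exists N, forall k, (N <= k)%N ->
  [/\ enorm (x k - xt) <= c, enorm (x k.+1 - xt) <= c, enorm (x k.+2 - xt) <= c,
      enorm (y k.+1 - xt) <= 3 * c & enorm (x k.+2 - y k.+1) <= 4 * c].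
Proof.
move=> c0; have [N _ NP] := (cvg_enorm _ _).1 x_cvg c c0.
have xc k : (N <= k)%N -> enorm (x k - xt) <= c by move=> /NP /ltW.
exists N => k Nk; have h0 := xc k Nk.
have h1 := xc k.+1 (leqW Nk); have h2 := xc k.+2 (leqW (leqW Nk)).
have h3 : enorm (y k.+1 - xt) <= 3 * c.
  have := enormB_le (y k.+1) (x k.+1) xt; have := restart_step k.
  have := enormB_le (x k.+1) xt (x k); rewrite (enormBC xt); lra.
split => //.
have := enormB_le (x k.+2) xt (y k.+1); rewrite (enormBC xt); lra.
Qed.

Let near_limit : exists N, forall k, (N <= k)%N ->
  [/\ enorm (x k.+1 - xt) <= r0 / 2, enorm (x k.+2 - xt) <= r0 / 2
     & enorm (y k.+1 - xt) <= r0].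
Proof.
have c0 : 0 < r0 / 4 by rewrite divr_gt0.
have [N NP] := close c0; exists N => k /NP[_ h1 h2 h3 _].
by split; lra.
Qed.

Let xi_grad k : enorm (x k - xt) <= r0 -> xi k = g2 (x k).
Proof. by move=> xk; apply: subgradient_grad; [exact: F2_diff|exact: xi_sub]. Qed.

(** The gradients of [F1] and [F2] give 2 K, the proximal term K / lam, the Bregman term 2 M K. *)
Let K0 := 2 * K + K / lam + 2 * M * K.

Let K0_gt0 : 0 < K0.
Proof. by rewrite /K0 !addr_gt0 ?mulr_gt0 ?invr_gt0. Qed.

Let subgradient_bound : exists N, forall k, (N <= k)%N -> forall e, 0 < e ->
  exists2 v, limiting_subdiff (EFin \o A) (row_mx (x k.+2) (x k.+1)) v
    & enorm v <= 2 * (K0 * (delta k + delta k.+1) + e).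
Proof.
have [N NP] := near_limit; exists N => k /NP[h1 h2 h3] e e0.
have r2 : 0 < r0 / 2 by rewrite divr_gt0.
have le1 : enorm (x k.+1 - xt) <= r0 by lra.
have le2 : enorm (x k.+2 - xt) <= r0 by lra.
have xy : enorm (x k.+2 - y k.+1) <= delta k + delta k.+1.
  have := enormB_le (x k.+2) (x k.+1) (y k.+1).
  by rewrite (enormBC (x k.+1) (y k.+1)); have := restart_step k; rewrite /delta; lra.
have [l1 l2 l3] := grad_lip le2 h3.
have [l4 l5 l6] := grad_lip le1 le2.
have [||||v vA vb] := @auxiliary_subgradient _ _ F1 F2 G H sigma M H_diff
  sigma_gt0 H_strong M_gt0 (x k.+2) (x k.+1) (zeta k.+1) K (r0 / 2) e A_lsc
  K_gt0 r2 e0.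
- by move=> w; exact: F1_convex.
- exact: zeta_sub.
- move=> w wr.
  have wt : enorm (w - xt) <= r0 := enormB_le_half wr h2.
  have [m1 m2 m3] := grad_lip wt le2; split; [|exact: m3|exact: m1].
  by have := F2_convex (x k.+2) wt; rewrite -opprB dotvNr lerNl opprB.
- exact: l4.
exists v => //; apply: le_trans vb _.
rewrite ler_pM2l// lerD2r -/g1 -/g2.
have bd : enorm (x k.+1 - x k.+2) = delta k.+1 by rewrite enormBC.
have d0 : 0 <= delta k by exact: enorm_ge0.
have d1 : 0 <= delta k.+1 by exact: enorm_ge0.
have il0 : 0 < lam^-1 by rewrite invr_gt0.
rewrite bd in l4 l5 l6 *.
(* Near the limit [xi] is the gradient of [F2], so the whole expression becomes a sum of gradient
   increments between nearby points. *)
rewrite /zeta xi_grad// subgradient_regroup.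
apply: le_trans _ (combination_bound (ltW K_gt0) (ltW il0) (ltW M_gt0) d0 d1 xy).
rewrite lerD2r; apply: le_trans (enorm_combination _ _ _ (ltW il0)) _.
apply: lerD.
  apply: lerD.
    exact: l2.
  exact: l6.
exact: ler_wpM2l (ltW il0) _ _ l1.
Qed.

Let zetat := g2 xt - g1 xt.

Let xt_r0 : enorm (xt - xt) <= r0. Proof. by rewrite subrr enorm0 ltW. Qed.

Let zeta_cvg : (fun k => zeta k.+1) @ \oo --> zetat.
Proof.
apply/cvg_enorm => e e0.
have il0 : 0 < lam^-1 by rewrite invr_gt0.
pose B := K * (4 + 4 / lam) + 1.
have B0 : 0 < B by rewrite /B addr_gt0// mulr_gt0// addr_gt0// divr_gt0.
pose c := Num.min (r0 / 4) (e / (2 * B)).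
have c0 : 0 < c by rewrite lt_min !divr_gt0// mulr_gt0.
have cr : c <= r0 / 4 by rewrite ge_min lexx.
have ce : c * (2 * B) <= e by rewrite -ler_pdivlMr ?mulr_gt0// ge_min lexx orbT.
have [N NP] := close c0; exists N => // k /= /NP[_ h1 h2 h3 h4].
have k1 : enorm (x k.+1 - xt) <= r0 by lra.
have k2 : enorm (x k.+2 - xt) <= r0 by lra.
have k3 : enorm (y k.+1 - xt) <= r0 by lra.
have [_ _ l1] := grad_lip k1 xt_r0.
have [_ l2 _] := grad_lip xt_r0 k3.
have [l3 _ _] := grad_lip k2 k3.
rewrite /zeta /zetat xi_grad// opprB addrC subgradient_regroup.
rewrite (enormBC xt) in l2.
apply: le_lt_trans (enorm_combination _ _ _ (ltW il0)) _.
apply: (@le_lt_trans _ _ (K * (3 * c) + K * c + lam^-1 * (K * (4 * c)))).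
  apply: lerD; first apply: lerD.
  - by apply: le_trans l2 _; rewrite ler_pM2l.
  - by apply: le_trans l1 _; rewrite ler_pM2l.
  - by rewrite ler_pM2l//; apply: le_trans l3 _; rewrite ler_pM2l.
apply: (@lt_le_trans _ _ (c * (2 * B))) => //.
have -> : c * (2 * B) = K * (3 * c) + K * c + lam^-1 * (K * (4 * c)) + (c * B + c).
  by rewrite /B; ring.
by rewrite ltrDl addr_gt0// mulr_gt0.
Qed.

Let x2_cvg : (fun k => x k.+2) @ \oo --> xt.
Proof.
apply/cvg_enorm => e e0; have [N _ NP] := (cvg_enorm _ _).1 x_cvg e e0.
by exists N => // k /= Nk; apply: NP; rewrite /= !leqW.
Qed.

Let G_near (e : R) : 0 < e -> \forall k \near \oo, G xt - e < G (x k.+2).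
Proof.
move=> e0; have [|U nU UP] := @G_lsc xt (G xt - e).
  by rewrite lte_fin; lra.
have xU : \forall k \near \oo, U (x k.+2) by exact: (x2_cvg nU).
by apply: filterS xU => k /UP; rewrite lte_fin.
Qed.

Let zetat_sub w : dotv zetat (w - xt) <= G w - G xt.
Proof.
apply/ler_addgt0Pr => e e0; have e2 : 0 < e / 2 by rewrite divr_gt0.
have wx : (fun k => w - x k.+2) @ \oo --> w - xt.
  by apply: cvgB => //; exact: cvg_cst.
have /cvgrPdist_lt/(_ _ e2) := dotv_cvg zeta_cvg wx.
move=> /(filterI (G_near e2))[N _ /(_ N (leqnn N))[h1 h2]].
have := zeta_sub N.+1 w; rewrite ltr_norml in h2; lra.
Qed.

(** Lower semicontinuity gives one side; the other is the subgradient inequality tested at [xt],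
    whose inner product tends to 0. *)
Let G_cvg : (fun k => G (x k.+2)) @ \oo --> G xt.
Proof.
apply/cvgrPdist_lt => e e0.
have xx : (fun k => xt - x k.+2) @ \oo --> xt - xt.
  by apply: cvgB => //; exact: cvg_cst.
have /cvgrPdist_lt/(_ _ e0) := dotv_cvg zeta_cvg xx.
apply: filterS2 (G_near e0) => k h1; rewrite subrr dotv0 !ltr_norml => h2.
by have := zeta_sub k.+1 xt; lra.
Qed.

Let V_cvg : V @ \oo --> Vt.
Proof.
rewrite -cvg_shiftS.
have -> : Vt = F1 xt - F2 xt + G xt + M * 0.
  by rewrite /Vt /A aux_real_row_mx bregxx.
rewrite (_ : (fun k => V k.+1) = fun k =>
  F1 (x k.+2) - F2 (x k.+2) + G (x k.+2) + M * D k.+1); last first.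
  by apply/funext => k; rewrite /V /A aux_real_row_mx.
have F1c : (fun k => F1 (x k.+2)) @ \oo --> F1 xt.
  by apply: (cvg_comp _ _ x2_cvg); exact: (differentiable_continuous (F1_diff xt)).
have F2c : (fun k => F2 (x k.+2)) @ \oo --> F2 xt.
  by apply: (cvg_comp _ _ x2_cvg); exact: (differentiable_continuous (F2_diff xt_r0)).
apply: cvgD; first by apply: cvgD G_cvg; exact: cvgB.
apply: cvgM; first exact: cvg_cst.
apply/cvgrPdist_lt => e e0.
(* The distance is at most 4 K c^2 <= 4 K c < 5 K c <= e. *)
pose c := Num.min (r0 / 4) (Num.min 1 (e / (5 * K))).
have c0 : 0 < c by rewrite !lt_min ltr01 !divr_gt0 ?mulr_gt0.
have cr : c <= r0 / 4 by rewrite ge_min lexx.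
have c1 : c <= 1 by rewrite !ge_min lexx orbT.
have ce : c * (5 * K) <= e by rewrite -ler_pdivlMr ?mulr_gt0// !ge_min lexx !orbT.
have [N NP] := close c0; exists N => // k /= /NP[_ h1 h2 _ _].
have k1 : enorm (x k.+1 - xt) <= r0 by lra.
have k2 : enorm (x k.+2 - xt) <= r0 by lra.
have [l1 _ _] := grad_lip k1 k2.
have h3 : enorm (x k.+1 - x k.+2) <= 2 * c.
  by have := enormB_le (x k.+1) xt (x k.+2); rewrite (enormBC xt); lra.
have D0 : 0 <= D k.+1 by exact: (breg_ge0 H_diff sigma_gt0 H_strong).
rewrite sub0r normrN ger0_norm//.
apply: le_lt_trans (breg_le H_diff sigma_gt0 H_strong _ _) _.
have h4 : dotv (gh (x k.+1) - gh (x k.+2)) (x k.+1 - x k.+2) <= K * (2 * c) * (2 * c).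
  by apply: dotv_le_of => //; apply: le_trans l1 _; rewrite ler_pM2l.
apply: le_lt_trans h4 _.
have s1 : K * c * c <= K * c * 1 by rewrite ler_pM2l ?mulr_gt0.
have s2 : 0 < K * c by rewrite mulr_gt0.
lra.
Qed.

Let V_ge k : Vt <= V k.
Proof.
apply/ler_addgt0Pr => e e0.
have /cvgrPdist_lt/(_ _ e0)[N _ NP] := V_cvg.
have := NP (maxn N k) (leq_maxl _ _); rewrite ltr_norml => h.
by have := V_mono (leq_maxr N k); lra.
Qed.

(** The KL property is only assumed where the limiting subdifferential is nonempty. *)
Let xt_subdiff : dom_subdiff (EFin \o A) (row_mx xt xt).
Proof.
have [||||v vA _] := @auxiliary_subgradient _ _ F1 F2 G H sigma M H_diff
  sigma_gt0 H_strong M_gt0 xt xt zetat K r0 1 A_lsc K_gt0 r0_gt0 ltr01.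
- by move=> w; exact: F1_convex.
- exact: zetat_sub.
- move=> w wr; have [m1 m2 m3] := grad_lip wr xt_r0; split; [|exact: m3|exact: m1].
  by have := F2_convex xt wr; rewrite -opprB dotvNr lerNl opprB.
- by rewrite !subrr enorm0 mulr0.
by exists v.
Qed.

Hypotheses (theta : R) (theta_lt1 : theta < 1).
Hypothesis A_KL : KL_function_with (power_desingularizing theta) (EFin \o A).

Let kl_bound : exists N K1, 0 < K1 /\ forall k, (N <= k)%N -> Vt < V k.+1 ->
  (V k.+1 - Vt) `^ theta <= K1 * (delta k + delta k.+1).
Proof.
have [_ _ /(_ _ xt_subdiff)[eta [U [phi [eta0 nU _ [c c0 phiE] KL]]]]] := A_KL.
have [N1 N1P] := subgradient_bound.
have zU : \forall k \near \oo, U (row_mx (x k.+2) (x k.+1)).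
  have [r rr rU] := nbhs_enorm nU.
  have r4 : 0 < r / 4 by rewrite divr_gt0.
  have [N NP] := close r4; exists N => // k /= /NP[_ h1 h2 _ _].
  apply: rU; rewrite opp_row_mx add_row_mx.
  by apply: le_trans (enorm_row_mx_le _ _) _; lra.
have Veta : \forall k \near \oo, ((V k.+1)%:E < Vt%:E + eta)%E.
  have [e e0 eE] : exists2 e : R, 0 < e & (e%:E <= eta)%E.
    case: eta eta0 {KL} => [e||]//; first by rewrite lte_fin => e0; exists e.
    by exists 1; rewrite ?leey.
  have := V_cvg; rewrite -cvg_shiftS => /cvgrPdist_lt/(_ _ e0).
  apply: filterS => k; rewrite ltr_norml/= => h.
  apply: (@lt_le_trans _ _ (Vt%:E + e%:E)%E); last by rewrite leeD2lE.
  by rewrite -EFinD lte_fin; lra.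
have [N2 _ N2P] := filterI zU Veta.
exists (maxn N1 N2), (2 * c * K0 * (1 - theta)).
split; first by rewrite !mulr_gt0// subr_gt0.
move=> k; rewrite geq_max => /andP[/N1P sub /N2P[/= kU ke]] Vk.
set s := V k.+1 - Vt.
have s0 : 0 < s by rewrite subr_gt0.
have kl : (1 <= (derive1 phi s)%:E *
    dist0 (limiting_subdiff (EFin \o A) (row_mx (x k.+2) (x k.+1))))%E.
  by apply: (KL _ kU) => //; rewrite lte_fin.
have dE : derive1 phi s = c * (1 - theta) * s `^ (- theta).
  have ds : is_derive s 1 (@powR R ^~ (1 - theta)) ((1 - theta) * s `^ (1 - theta - 1)).
    exact: is_derive1_powR.
  rewrite phiE derive1E (_ : (fun t => c * t `^ (1 - theta)) = c *: (@powR R ^~ (1 - theta)))//.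
  rewrite deriveZ; last exact: (@ex_derive _ _ _ _ _ _ _ ds).
  rewrite (@derive_val _ _ _ _ _ _ _ ds) addrAC subrr add0r.
  exact: mulrA.
rewrite dE in kl.
have co0 : 0 < c * (1 - theta) * s `^ (- theta).
  by rewrite !mulr_gt0 ?subr_gt0// powR_gt0.
have : 1 <= c * (1 - theta) * s `^ (- theta) * (2 * (K0 * (delta k + delta k.+1))).
  apply/ler_addgt0Pr => e e0.
  (* Scaled so that the slack of [subgradient_bound] contributes exactly [e], which is arbitrary. *)
  pose e' := e / (2 * (c * (1 - theta) * s `^ (- theta))).
  have e'0 : 0 < e' by rewrite divr_gt0// mulr_gt0.
  have [v vA vb] := sub e' e'0.
  have : (dist0 (limiting_subdiff (EFin \o A) (row_mx (x k.+2) (x k.+1))) <= (enorm v)%:E)%E.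
    by apply: ereal_inf_lbound; exists v.
  move=> /(lee_wpmul2l (_ : (0 <= (c * (1 - theta) * s `^ (- theta))%:E)%E)).
  rewrite lee_fin (ltW co0) => /(_ isT)/(le_trans kl).
  rewrite -EFinM lee_fin => h; apply: le_trans h _.
  apply: le_trans (ler_wpM2l (ltW co0) vb) _.
  have : c * (1 - theta) * s `^ (- theta) * e' * 2 = e.
    rewrite /e'; move: co0; move: (_ * s `^ _) => X X0.
    by field; rewrite gt_eqF.
  lra.
have st0 : 0 < s `^ theta by rewrite powR_gt0.
rewrite -(ler_pM2l st0) mulr1 powRN => h; apply: le_trans h _.
rewrite le_eqVlt; apply/orP; left; apply/eqP.
move: st0; move: (s `^ theta) => X X0.
by field; rewrite gt_eqF.
Qed.

Let step_cvg (e : R) : 0 < e -> exists N, forall k, (N <= k)%N -> delta k < e.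
Proof.
move=> e0; have e4 : 0 < e / 4 by rewrite divr_gt0.
have [N NP] := close e4; exists N => k /NP[h0 h1 _ _ _].
have := enormB_le (x k.+1) xt (x k); rewrite (enormBC xt) /delta => h.
apply: le_lt_trans h _; lra.
Qed.

(** Here the KL bound reads 1 <= K1 (delta_k + delta_{k+1}) and fails once steps are below 1/(2 K1).
    So [V] attains its limit, and the decrease then forbids any further move. *)
Lemma iterates_constant : theta = 0 ->
  exists N, exists a, forall k, (N <= k)%N -> x k = a.
Proof.
move=> t0; have [N [K1 [K10 kl]]] := kl_bound.
have e0 : 0 < (2 * K1)^-1 by rewrite invr_gt0 mulr_gt0.
have [N1 N1P] := step_cvg e0.
pose N2 := maxn N N1.
have Vc k : (N2 <= k)%N -> V k.+1 = Vt.
  rewrite geq_max => /andP[k0 k1]; apply/eqP; rewrite eq_le V_ge andbT leNgt.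
  apply/negP => /(kl _ k0); rewrite t0 powRr0.
  have h := ltrD (N1P _ k1) (N1P _ (leqW k1)).
  apply/negP; rewrite -ltNge; rewrite -(ltr_pM2l K10) in h.
  apply: (lt_le_trans h); rewrite invfM mulrDr mulrCA mulfV ?gt_eqF//; lra.
exists N2.+3, (x N2.+3) => k.
have xS j : (N2.+3 <= j)%N -> x j.+1 = x j.
  case: j => [//|[//|[//|j]]]; rewrite !ltnS => Nj.
  have := decrease j.+1; rewrite !Vc ?leqW// subrr.
  have c0 : 0 < (1 - rho) / lam * (sigma / 4).
    by rewrite mulr_gt0// divr_gt0// subr_gt0.
  rewrite pmulr_rle0// => h; apply/subr0_eq/dotv_eq0.
  have d1 : 0 <= delta j.+2 by exact: enorm_ge0.
  have d2 : 0 <= delta j.+3 by exact: enorm_ge0.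
  have : delta j.+3 ^+ 2 <= (delta j.+2 + delta j.+3) ^+ 2.
    by rewrite ler_pXn2r ?nnegrE ?addr_ge0// lerDr.
  move=> /le_trans/(_ h); rewrite /delta enorm_sqr => h'.
  by apply/eqP; rewrite eq_le h' dotv_ge0.
by move=> Nk; rewrite -(subnK Nk); elim: (k - _)%N => // i IH; rewrite addSn xS// leq_addl.
Qed.

(** For positive [theta] the power of 0 is 0, so the KL bound persists when [V] has already reached
    its limit. *)
Let rate_input : 0 < theta -> exists N K1, [/\ 0 < K1,
  forall k, 0 <= V (N + k).+1 - Vt <= 1 &
  forall k, (V (N + k).+1 - Vt) `^ theta <= K1 * (delta (N + k) + delta (N + k).+1)].
Proof.
move=> t0; have [N [K1 [K10 kl]]] := kl_bound.
have /cvgrPdist_lt/(_ _ ltr01)[N1 _ N1P] := V_cvg.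
exists (maxn N N1), K1; split=> // k.
- rewrite subr_ge0 V_ge/=; have Nk : (N1 <= (maxn N N1 + k).+1)%N.
    by rewrite leqW// (leq_trans (leq_maxr N N1))// leq_addr.
  have := N1P _ Nk; rewrite /= distrC => h.
  exact: le_trans (ler_norm _) (ltW h).
have Nk : (N <= maxn N N1 + k)%N by rewrite (leq_trans (leq_maxl N N1))// leq_addr.
have := V_ge (maxn N N1 + k).+1; rewrite le_eqVlt => /predU1P[<-|]; last exact: kl.
rewrite subrr powR0 ?gt_eqF// mulr_ge0 ?(ltW K10)//.
by apply: addr_ge0; exact: enorm_ge0.
Qed.

Let m := (1 - rho) / lam * (sigma / 4).

Let m_gt0 : 0 < m.
Proof. by rewrite /m mulr_gt0// divr_gt0// subr_gt0. Qed.

Let shift_cvg N : (fun k => x (N + k).+1) @ \oo --> xt.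
Proof.
apply/cvg_enorm => e e0; have [N1 _ NP] := (cvg_enorm _ _).1 x_cvg e e0.
by exists N1 => // k /= Nk; apply: NP; rewrite /= leqW// (leq_trans Nk)// leq_addl.
Qed.

Let shift_decr N k : V (N + k.+1).+1 - Vt <= V (N + k).+1 - Vt.
Proof. by rewrite lerD2r addnS V_decr. Qed.

Let shift_step N k : enorm (x (N + k.+1).+1 - x (N + k).+1) <=
  delta (N + k.+1) + delta (N + k.+1).+1.
Proof. by rewrite addnS lerDl enorm_ge0. Qed.

Let shift_descent N k : m * (delta (N + k.+2) + delta (N + k.+2).+1) ^+ 2 <=
  (V (N + k).+1 - Vt) - (V (N + k.+3).+1 - Vt).
Proof. by rewrite !addnS opprB addrA subrK; exact: decrease. Qed.

Lemma iterates_linear_rate : 0 < theta <= 2^-1 ->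
  exists c N eta, [/\ 0 < c, 0 < eta < 1
    & forall k, (N <= k)%N -> enorm (x k - xt) <= c * eta ^+ k].
Proof.
move=> /andP[t0 t2]; have [N [K1 [K10 s01 kl]]] := rate_input t0.
have t01 : 0 < theta < 1 by rewrite t0 theta_lt1.
have [c [eta [c0 /andP[eta0 eta1] rate]]] := kl_linear_rate (shift_cvg N) m_gt0 K10 t01 s01
  (shift_decr N) (shift_step N) (shift_descent N) kl t2.
exists (c / eta ^+ (N + 4)), (N + 4)%N, eta; split.
- by rewrite divr_gt0// exprn_gt0.
- by rewrite eta0.
move=> k Nk; have := rate (k - (N + 4))%N.
rewrite shift_index//.
move=> h; apply: le_trans h _.
have -> : eta ^+ k = eta ^+ (k - (N + 4)) * eta ^+ (N + 4) by rewrite -exprD subnK.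
by rewrite mulrACA mulVf ?mulr1// gt_eqF// exprn_gt0.
Qed.

Lemma iterates_sublinear_rate : 2^-1 < theta ->
  exists c N, 0 < c /\ forall k, (N <= k)%N -> enorm (x k - xt) <=
    c * k%:R `^ (- ((1 - theta) / (2 * theta - 1))).
Proof.
move=> t2; have t0 : 0 < theta by apply: lt_trans t2; rewrite invr_gt0.
have [N [K1 [K10 s01 kl]]] := rate_input t0.
have t01 : 0 < theta < 1 by rewrite t0 theta_lt1.
have [c c0 rate] := kl_sublinear_rate (shift_cvg N) m_gt0 K10 t01 s01
  (shift_decr N) (shift_step N) (shift_descent N) kl t2.
set tau := (1 - theta) / _ in rate *.
have tau0 : 0 <= tau.
  rewrite divr_ge0 ?subr_ge0 ?(ltW theta_lt1)//.
  by move: t2; rewrite -(ltr_pM2l (ltr0Sn R 1)) mulfV ?pnatr_eq0// => /ltW.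
exists (c * (N + 4)%:R `^ tau), (N + 4)%N; split.
  by rewrite mulr_gt0// powR_gt0// ltr0n addn4.
move=> k Nk; have := rate (k - (N + 4))%N.
rewrite shift_index//.
move=> h; apply: le_trans h _; rewrite -mulrA ler_pM2l//.
have k0 : (0 : R) < k%:R by rewrite ltr0n (leq_trans _ Nk)// addn4.
rewrite !powRN ler_pdivlMr ?powR_gt0// mulrC ler_pdivrMr ?powR_gt0//.
rewrite -powRM//; apply: ge0_ler_powR; rewrite ?nnegrE//.
by rewrite -natrM ler_nat shift_index_le.
Qed.

End Iterates.

(** * From the algorithm to the real-valued setting *)

Lemma lipschitz_enorm (R : realType) (n : nat) (F : 'rV[R]_n -> 'rV[R]_n)
    (A : set 'rV[R]_n) : [lipschitz F x | x in A] ->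
  exists2 K, 0 < K & forall u v, A u -> A v ->
    enorm (F u - F v) <= K * enorm (u - v).
Proof.
move=> [M0 [_ MP]]; pose M := `|M0| + 1.
have M0M : M0 < M by rewrite /M; have := ler_norm M0; lra.
have s0 : 0 <= Num.sqrt (n%:R : R) by exact: sqrtr_ge0.
have M1 : 0 < M by rewrite /M; have := normr_ge0 M0; lra.
exists (Num.sqrt n%:R * M + 1) => [|u v Au Av].
  by rewrite ltr_wpDl// mulr_ge0// ltW.
have /= h : `|F u - F v| <= M * `|u - v| by exact: (MP M M0M (u, v) (conj Au Av)).
apply: le_trans (enorm_le_norm _) _.
have h1 := norm_le_enorm (u - v).
apply: le_trans (ler_wpM2l s0 h) _.
rewrite mulrA mulrDl mul1r; apply: le_trans (_ : Num.sqrt n%:R * M * enorm (u - v) <= _).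
  by rewrite ler_wpM2l// mulr_ge0// ltW.
by rewrite lerDl enorm_ge0.
Qed.

Lemma econvex_grad (R : realType) (n : nat) (F : 'rV[R]_n -> R) (v : 'rV[R]_n) :
  differentiable F v -> econvex (EFin \o F) ->
  forall u, dotv (grad (EFin \o F) v) (u - v) <= F u - F v.
Proof.
move=> dF cF u; apply: convex_grad => // t t01.
by have := @cF u v t I I t01.
Qed.

Lemma fin_EFin (R : realType) (T : Type) (f : T -> \bar R) :
  (forall x, f x \is a fin_num) -> exists F, f = EFin \o F.
Proof.
by move=> ff; exists (fine \o f); apply/funext => x; rewrite /= fineK.
Qed.

Lemma extrapolate_le (R : realType) (n : nat) (t : R * R) (u v : 'rV[R]_n) :
  1 <= t.1 <= t.2 -> enorm (extrapolate t u v - v) <= enorm (v - u).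
Proof.
move=> /andP[t1 t2]; have t20 : 0 < t.2 by apply: lt_le_trans t2; lra.
rewrite /extrapolate addrAC subrr add0r enormZ ger0_norm; last first.
  by rewrite divr_ge0 ?subr_ge0 ?(ltW t20).
by rewrite ler_piMl ?enorm_ge0// ler_pdivrMr//; lra.
Qed.

Lemma theta_step (R : realType) (t : R) : 1 <= t -> t <= (1 + Num.sqrt (1 + 4 * t ^+ 2)) / 2.
Proof.
move=> t1; rewrite ler_pdivlMr//.
have : Num.sqrt ((2 * t) ^+ 2) <= Num.sqrt (1 + 4 * t ^+ 2).
  by rewrite ler_wsqrtr//; lra.
rewrite sqrtr_sqr ger0_norm; last by lra.
lra.
Qed.

Lemma BPDCAe_real (R : realType) (d : nat) (F1 F2 G H : 'rV[R]_d -> R)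
    (lam rho : R) (x : nat -> 'rV[R]_d) : 0 <= rho ->
  (forall u v, 0 <= breg H u v) ->
  BPDCAe setT (EFin \o F1) (EFin \o F2) (EFin \o G) (EFin \o H) lam rho x ->
  exists xi y : nat -> 'rV[R]_d, [/\
    forall k w, dotv (xi k) (w - x k) <= F2 w - F2 (x k),
    forall k w, G (x k.+1) + dotv (grad (EFin \o F1) (y k) - xi k) (x k.+1 - y k)
        + lam^-1 * breg H (x k.+1) (y k) <=
      G w + dotv (grad (EFin \o F1) (y k) - xi k) (w - y k) + lam^-1 * breg H w (y k),
    forall k, breg H (x k.+1) (y k.+1) <= rho * breg H (x k) (x k.+1)
    & forall k, enorm (y k.+1 - x k.+1) <= enorm (x k.+1 - x k)].
Proof.
move=> rho0 D0 [_ [xi [y [t [t0 step]]]]].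
(* This invariant survives a restart and keeps the extrapolation coefficient in [0, 1]. *)
have t_ge k : 1 <= (t k).1 <= (t k).2.
  elim: k => [|k IH]; first by rewrite t0 lexx.
  have [_ _ -> _] := step k; case: ifP => _ /=.
    by rewrite lexx theta_step.
  have /andP[h1 h2] := IH.
  by rewrite (le_trans h1 h2) theta_step// (le_trans h1).
exists xi, y; split.
- move=> k w; have [/(_ w) h _ _ _] := step k.
  have {h} : 0 <= F2 w - F2 (x k) - dotv (xi k) (w - x k) by exact: h.
  by rewrite subr_ge0.
- move=> k w; have [_ _ _ [_ h]] := step k.
  by have := h w; rewrite closureT => /(_ I).
(* After a restart y = x and the left side is 0; otherwise the failed test is the inequality
   itself. *)
- move=> k; have [_ -> _ _] := step k.+1; case: ifPn => [_|/asboolPn/not_orP[_ h]].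
    by rewrite /extrapolate subrr mul0r scale0r addr0 bregxx mulr_ge0.
  by move/negP: h; rewrite !bregman_EFin -EFinM lte_fin -leNgt.
move=> k; have [_ -> _ _] := step k.+1; apply: extrapolate_le.
by case: ifP => _ //=; rewrite lexx.
Qed.

(** Boundedness below yields finiteness of [f2]: where it is infinite, the objective would be
    -oo. *)
Lemma finite_objective (R : realType) (d : nat) (C : set 'rV[R]_d)
    (f1 f2 g h : 'rV[R]_d -> \bar R) : C = setT -> edom h = setT ->
  basic_assumptions C f1 f2 g h ->
  [/\ forall x, f1 x \is a fin_num, forall x, f2 x \is a fin_num
    & forall x, g x \is a fin_num].
Proof.
move=> CT hT [_ _ _ _ f1g f1C [f2p _] _ [gp _] _ _ bb _].
have f1fin x : f1 x \is a fin_num by apply: f1C.1; rewrite CT.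
have gfin x : g x \is a fin_num.
  have : edom h x by rewrite hT.
  move=> /f1g; rewrite /edom /=; have := gp x; have := f1fin x.
  by case: (f1 x) => [r||]//; case: (g x).
split=> // x; rewrite fin_numE gt_eqF//=; apply/negP => /eqP f2x.
move: bb; rewrite ltNge => /negP; apply; apply: ereal_inf_lbound.
exists x; first by rewrite CT closureT.
rewrite /objective f2x; move: (f1fin x) (gfin x).
by case: (f1 x) => [r||]//; case: (g x).
Qed.

Theorem theorem9 (R : realType) (d : nat) (C : set 'rV[R]_d)
  (f1 f2 g h : 'rV[R]_d -> \bar R) (L sigma lam rho M theta : R)
  (N0 : set 'rV[R]_d) (x : nat -> 'rV[R]_d) (xt : 'rV[R]_d)
  (C_nonempty : C !=set0) (C_convex : convex_set C) (C_open : open C)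
  (rho_ge0 : 0 <= rho) (rho_lt1 : rho < 1)
  (basic : basic_assumptions C f1 f2 g h)
  (f1_smad : smad C f1 h L)
  (sub_in_C : forall (u y xi : 'rV[R]_d) (lam' : R), C u -> C y ->
     convex_subdiff f2 u xi -> 0 < lam' ->
     subproblem C f1 g h lam' y xi `<=` C)
  (h_dom : edom h = setT)
  (sigma_gt0 : 0 < sigma) (h_strong : strongly_convex sigma h)
  (gradh_lip : lipschitz_on_bounded (grad h))
  (gradf1_lip : lipschitz_on_bounded (grad f1))
  (psi_level : level_bounded (objective f1 f2 g))
  (N0_open : open N0) (N0_crit : limiting_critical f1 f2 g `<=` N0)
  (f2_C1 : C1_on N0 f2) (gradf2_lip : locally_lipschitz_on N0 (grad f2))
  (g_convex : econvex g)
  (clarke_bounded : forall B : set 'rV[R]_d, bounded_set B ->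
     exists u : 'rV[R]_d -> 'M[R]_d,
       (forall z, B z -> clarke_jacobian (grad h) z (u z)) /\
       [bounded u z | z in B])
  (lam_gt0 : 0 < lam) (lamL_lt1 : lam * L < 1)
  (x_gen : BPDCAe C f1 f2 g h lam rho x)
  (x_cvg : x @ \oo --> xt) (xt_crit : limiting_critical f1 f2 g xt)
  (M_gt0 : 0 < M) (M_lower : rho / lam <= M) (M_upper : M <= lam^-1)
  (theta_ge0 : 0 <= theta) (theta_lt1 : theta < 1)
  (H_KL : KL_function_with (power_desingularizing theta)
            (auxiliary f1 f2 g h M)) :
  (theta = 0 ->
     exists k0 : nat, (0 < k0)%N /\
       exists a : 'rV[R]_d, forall k : nat, (k0 < k)%N -> x k = a) /\
  (0 < theta <= 2^-1 ->
     exists (c1 : R) (k1 : nat) (eta : R),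
       [/\ 0 < c1, (0 < k1)%N, 0 < eta < 1
         & forall k : nat, (k1 < k)%N -> enorm (x k - xt) < c1 * eta ^+ k]) /\
  (2^-1 < theta < 1 ->
     exists (c2 : R) (k2 : nat),
       [/\ 0 < c2, (0 < k2)%N
         & forall k : nat, (k2 < k)%N ->
             enorm (x k - xt)
               < c2 * k%:R `^ (- ((1 - theta) / (2 * theta - 1)))]).
Proof.
have CT : C = setT.
  by have [_ [_ _ <- _]] := ba_kernel basic; rewrite h_dom interiorT.
have [f1fin f2fin gfin] := finite_objective CT h_dom basic.
have hfin y : h y \is a fin_num.
  by have [_ [_ _ _ [hf _]]] := ba_kernel basic; apply: hf; rewrite CT.
have [F1 e1] := fin_EFin f1fin; have [F2 e2] := fin_EFin f2fin.
have [G eg] := fin_EFin gfin; have [H eh] := fin_EFin hfin.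
subst C f1 f2 g h; clear f1fin f2fin gfin hfin.
have H_diff y : differentiable H y.
  by have [_ [_ _ _ [_ [hd _]]]] := ba_kernel basic; exact: (hd y I).
have F1_diff y : differentiable F1 y.
  by have [_ [fd _]] := ba_f1_C1 basic; exact: (fd y I).
have F1_convex u v := econvex_grad (F1_diff v) (ba_f1_convex basic) u.
have [[L_gt0 _ _ _] [_ _ smad_cvx _]] := f1_smad.
have F1_smad u v := smad_upper H_diff u (F1_diff v) smad_cvx.
have D0 := breg_ge0 H_diff sigma_gt0 h_strong.
have [xi [y [xi_sub y_min y_breg y_step]]] := BPDCAe_real rho_ge0 D0 x_gen.
have zeta_sub k w : dotv (xi k - grad (EFin \o F1) (y k) - lam^-1 *:
    (grad (EFin \o H) (x k.+1) - grad (EFin \o H) (y k))) (w - x k.+1) <=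
    G w - G (x k.+1).
  have := prox_subgradient H_diff lam_gt0 g_convex (y_min k) w.
  by rewrite opprB.
have xtN : N0 xt by exact: N0_crit.
have [V nV Vlip] := gradf2_lip xt xtN.
(* On this ball [f2] is differentiable with Lipschitz gradient. *)
have [r0 r0_gt0 r0V] := nbhs_enorm (filterI nV (open_nbhs_nbhs (conj N0_open xtN))).
pose B := [set u | enorm (u - xt) <= r0].
have Bb : bounded_set B by apply: compact_bounded; exact: compact_enorm_ball.
have [K1 K10 K1P] := lipschitz_enorm (gradh_lip B Bb).
have [K2 K20 K2P] := lipschitz_enorm (gradf1_lip B Bb).
have [K3 K30 K3P] := lipschitz_enorm Vlip.
pose K := K1 + K2 + K3.
have K0 : 0 < K by rewrite !addr_gt0.
have grad_lip u v : enorm (u - xt) <= r0 -> enorm (v - xt) <= r0 ->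
  [/\ enorm (grad (EFin \o H) u - grad (EFin \o H) v) <= K * enorm (u - v),
      enorm (grad (EFin \o F1) u - grad (EFin \o F1) v) <= K * enorm (u - v)
    & enorm (grad (EFin \o F2) u - grad (EFin \o F2) v) <= K * enorm (u - v)].
  move=> uB vB; split.
  - apply: le_trans (K1P _ _ uB vB) _; rewrite ler_wpM2r ?enorm_ge0//.
    by rewrite /K -addrA lerDl addr_ge0 ?ltW.
  - apply: le_trans (K2P _ _ uB vB) _; rewrite ler_wpM2r ?enorm_ge0//.
    by rewrite /K addrAC lerDr addr_ge0 ?ltW.
  - apply: le_trans (K3P _ _ (r0V _ uB) (r0V _ vB)) _; rewrite ler_wpM2r ?enorm_ge0//.
    by rewrite /K lerDr addr_ge0 ?ltW.
have F2_diff u : enorm (u - xt) <= r0 -> differentiable F2 u.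
  by move=> /r0V[_ uN]; have [_ [fd _]] := f2_C1; exact: (fd u uN).
have F2_convex u v : enorm (v - xt) <= r0 ->
    dotv (grad (EFin \o F2) v) (u - v) <= F2 u - F2 v.
  by move=> /F2_diff dF; exact: econvex_grad dF (ba_f2_convex basic) u.
have [_ A_lsc _] := H_KL.
split; last split.
- move=> t0.
  have [N [a xa]] := iterates_constant sigma_gt0 lam_gt0 lamL_lt1 rho_lt1 M_gt0
    M_lower M_upper K0 r0_gt0 H_diff h_strong F1_diff F1_convex F1_smad
    (ba_g_lsc basic) A_lsc grad_lip F2_diff F2_convex xi_sub zeta_sub y_breg y_step
    x_cvg theta_lt1 H_KL t0.
  by exists N.+1; split=> //; exists a => k /ltnW/ltnW; exact: xa.
- move=> t2.
  have [c [N [eta [c0 eta01 rate]]]] := iterates_linear_rate sigma_gt0 lam_gt0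
    lamL_lt1 rho_lt1 M_gt0 M_lower M_upper K0 r0_gt0 H_diff h_strong F1_diff
    F1_convex F1_smad (ba_g_lsc basic) A_lsc grad_lip F2_diff F2_convex xi_sub
    zeta_sub y_breg y_step x_cvg theta_lt1 H_KL t2.
  have /andP[eta0 _] := eta01.
  (* Enlarging [c] makes the estimate strict, and [N.+1] is a positive threshold. *)
  exists (c + 1), N.+1, eta; split=> // [|k /ltnW/ltnW/rate h].
    by rewrite addr_gt0.
  by apply: le_lt_trans h _; rewrite ltr_pM2r ?exprn_gt0// ltrDl.
move=> /andP[t2 _].
have [c [N [c0 rate]]] := iterates_sublinear_rate sigma_gt0 lam_gt0
  lamL_lt1 rho_lt1 M_gt0 M_lower M_upper K0 r0_gt0 H_diff h_strong F1_diff
  F1_convex F1_smad (ba_g_lsc basic) A_lsc grad_lip F2_diff F2_convex xi_sub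
  zeta_sub y_breg y_step x_cvg theta_lt1 H_KL t2.
exists (c + 1), N.+1; split=> // [|k Nk].
  by rewrite addr_gt0.
apply: le_lt_trans (rate _ (ltnW (ltnW Nk))) _.
by rewrite ltr_pM2r ?ltrDl// powR_gt0// ltr0n (leq_trans _ Nk).
Qed.
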